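(* Let $(\mathcal{D},\epsilon)$ be a tensor manifold. The middle-four-interchange law holds for $\otimes_\epsilon$ and $\circ_\epsilon$: for all morphisms $f_1,g_1,f_2,g_2$ of $\mathcal{D}$ with $t(f_1)=s(g_1)$ and $t(f_2)=s(g_2)$, $$(g_1\otimes_\epsilon g_2)\circ_\epsilon(f_1\otimes_\epsilon f_2)=(g_1\circ_\epsilon f_1)\otimes_\epsilon(g_2\circ_\epsilon f_2).$$
   Context: Planar graphs. A graph is a triple $(H,P,\sigma)$ with $H$ a finite set (half-edges), $P$ a partition of $H$ into nonempty blocks (vertices), $\sigma$ an involution of $H$ (its orbits are the edges), such that a vertex containing a two-element $\sigma$-orbit equals that orbit; such vertices and edges are called virtual, all other vertices real. A leg is a half-edge fixed by $\sigma$ (real leg) or lying in a virtual edge (virtual leg). An orientation $\mathrm{sgn}:H\to\{+,-\}$ takes different values on the two elements of each two-element orbit; $In(v),Out(v)$ (resp. $In(\Gamma),Out(\Gamma)$) are the sets of half-edges in $v$ (resp. of legs) of sign $+$, $-$. The graph is directed if all $In(v),Out(v)$ are nonempty. The source (target) of an edge is the vertex containing its $-$ ($+$) half-edge, if there is one; $e\to e'$ means there are edges $e=e_1,\dots,e_n=e'$, $n\ge 1$, with the target of $e_i$ equal to the source of $e_{i+1}$. A planar graph is a directed graph with a linear order $\prec$ on its edges such that for all distinct edges: $e_1\to e_2$ implies $e_1\prec e_2$; and if $e_1\to e_2$ and $e_1\prec e_3\prec e_2$ then $e_1\to e_3$ or $e_3\to e_2$. The sets $In(\cdot)$, $Out(\cdot)$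 are ordered by $\prec$ applied to the edges containing their elements. A graph is unitary if it consists of exactly one virtual vertex; prime if it has exactly one vertex and is not unitary. $\Gamma_1\otimes\Gamma_2$ is the disjoint union, with all edges of $\Gamma_1$ preceding those of $\Gamma_2$. If $Out(\Gamma_1)=\{o_1,\dots,o_n\}$ and $In(\Gamma_2)=\{i_1,\dots,i_n\}$ in increasing order, $\Gamma_2\circ\Gamma_1$ is obtained from the disjoint union by grafting $o_k$ to $i_k$ for each $k$: if both are real legs, join them into an edge $\bar e_k=\{o_k,i_k\}$; if exactly one is virtual, delete its virtual edge, the edge of the other being $\bar e_k$; if both are virtual, delete $o_k,i_k$ and let $\bar e_k=\{\sigma_1(o_k),\sigma_2(i_k)\}$ be a virtual edge (and a virtual vertex). The order of edges is $A_1,\bar e_1,B_1,\dots,A_n,\bar e_n,B_n$, where $A_k$ is the set of edges of $\Gamma_1$ strictly between the edges of $o_{k-1}$ and $o_k$ (before that of $o_1$ if $k=1$) and $B_k$ the set of edges of $\Gamma_2$ strictly between the edges of $i_k$ and $i_{k+1}$ (after that of $i_n$ if $k=n$), each with its own order. Tensor manifolds. $W(S)$ is the set of words (including the empty one) in $S$. A tensor scheme $\mathcal{D}$ consists of sets $Ob(\mathcal{D})$, $Mor(\mathcal{D})$ and maps $s,t:Mor(\mathcal{D})\to W(Ob(\mathcal{D}))$ whose values are nonempty words; morphisms of tensor schemes are pairs of maps $(\varphi_o,\varphi_m)$ compatible with $s,t$. A diagram in $\mathcal{D}$ is a planar graph $\Gamma$ with a $\sigma$-invariant map $\gamma_o$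 from half-edges to $Ob(\mathcal{D})$ and a map $\gamma_m$ from real vertices to $Mor(\mathcal{D})$ such that $s(\gamma_m(v))$, $t(\gamma_m(v))$ are the words of values of $\gamma_o$ along $In(v)$, $Out(v)$; its domain and codomain are the words along $In(\Gamma)$, $Out(\Gamma)$. Diagrams are taken up to bijections of half-edges preserving all structure; tensor product and composition are those of planar graphs with inherited decorations; they form a strict monoidal category $F(\mathcal{D})$ with objects $W(Ob(\mathcal{D}))$ under concatenation, identities being tensor products of unitary diagrams. $T(\mathcal{D})$ is the tensor scheme with $Ob(T(\mathcal{D}))=W(Ob(\mathcal{D}))$ whose morphisms are bracketed diagrams $(w_1\cdots w_m;u_1\cdots u_n;\Gamma)$, $m,n\ge1$, with $w_i,u_j\in W(Ob(\mathcal{D}))$ and $\Gamma$ a diagram in $\mathcal{D}$ with domain the concatenation of the $w_i$ and codomain that of the $u_j$; source $w_1\cdots w_m$, target $u_1\cdots u_n$ (words in words). $T$ acts on morphisms by relabelling. $\eta_{\mathcal{D}}:\mathcal{D}\to T(\mathcal{D})$ sends $x$ to the one-letter word $(x)$ and $f:x_1\cdots x_m\to y_1\cdots y_n$ to $((x_1)\cdots(x_m);(y_1)\cdots(y_n);\Gamma_f)$, with $\Gamma_f$ the prime diagram with vertex decorated by $f$. $\mu_{\mathcal{D}}:TT(\mathcal{D})\to T(\mathcal{D})$ concatenates words of words and sends a bracketed diagram $\Delta$ in $T(\mathcal{D})$ to its value in $F(\mathcal{D})$ (the diagram in $\mathcal{D}$ obtained by tensoring and composing, as prescribed by $\Delta$,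 the diagrams decorating its vertices), each bracket being concatenated. A tensor manifold is an algebra $(\mathcal{D},\epsilon)$ of the monad $(T,\mu,\eta)$: a morphism of tensor schemes $\epsilon=(\epsilon_o,\epsilon_m):T(\mathcal{D})\to\mathcal{D}$ with $\epsilon\circ T(\epsilon)=\epsilon\circ\mu_{\mathcal{D}}$ and $\epsilon\circ\eta_{\mathcal{D}}=Id$. Operations. For $f:x_1\cdots x_m\to y_1\cdots y_n$ and $g:u_1\cdots u_k\to v_1\cdots v_l$ in $\mathcal{D}$, $f\otimes_\epsilon g=\epsilon_m\big((x_1)\cdots(x_m)(u_1)\cdots(u_k);(y_1)\cdots(y_n)(v_1)\cdots(v_l);\Gamma_f\otimes\Gamma_g\big)$. For $f:x_1\cdots x_l\to y_1\cdots y_m$ and $g:y_1\cdots y_m\to z_1\cdots z_n$, $g\circ_\epsilon f=\epsilon_m\big((x_1)\cdots(x_l);(z_1)\cdots(z_n);\Gamma_g\circ\Gamma_f\big)$. Here every bracket is a one-letter word. *)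

(* Defs.v *)
From HB Require Import structures.
From mathcomp Require Import all_boot.

Set Implicit Arguments.
Unset Strict Implicit.
Unset Printing Implicit Defensive.

(* The partition of the half-edges into vertices is given by the equivalence
   relation [vtx] "lying in the same vertex"; [pos h] says that h has sign +;
   the order on edges is given by the relation [prec] it induces on
   half-edges: [prec a b] says that the edge of a strictly precedes that of b. *)
Record pregraph := Pregraph {
  half :> finType;
  vtx : rel half;
  opp : half -> half;
  pos : pred half;
  prec : rel half }.

Section PregraphNotions.
Context {G : pregraph}.
Implicit Types a b h : G.

Definition same_edge a b := (b == a) || (b == opp a).

Definition virt h := (opp h != h) && vtx h (opp h).

Definition leg h := (opp h == h) || virt h.

(* The target of the edge of a is the source of the edge of b. *)
Definition step a b :=
  [exists x, exists y,
     [&& same_edge a x, pos x, same_edge b y, ~~ pos y & vtx x y]].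

(* The relation e -> e' between the edges of a and b; a chain consisting of a
   single edge is allowed. *)
Definition reach a b := same_edge a b || connect step a b.

(* The elements of A in increasing order of their edges; it is only used for
   sets of half-edges of equal sign, whose edges are distinct. *)
Definition osort (A : {set G}) : seq G :=
  sort (fun a b => ~~ prec b a) (enum A).

Definition inV h := [set x | vtx h x & pos x].
Definition outV h := [set x | vtx h x & ~~ pos x].
Definition inG : {set G} := [set x | leg x & pos x].
Definition outG : {set G} := [set x | leg x & ~~ pos x].

End PregraphNotions.
Arguments inG G : clear implicits.
Arguments outG G : clear implicits.

Record planar (G : pregraph) : Prop := Planar {
  vtx_equiv : equivalence_rel (@vtx G);
  oppK : involutive (@opp G);
  virtP : forall h h' : G, virt h -> vtx h h' -> same_edge h h';
  pos_opp : forall h : G, opp h != h -> pos (opp h) = ~~ pos h;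
  has_in : forall h : G, inV h != set0;
  has_out : forall h : G, outV h != set0;
  prec_oppl : forall a b : G, prec (opp a) b = prec a b;
  prec_oppr : forall a b : G, prec a (opp b) = prec a b;
  prec_irr : irreflexive (@prec G);
  prec_trans : transitive (@prec G);
  prec_total : forall a b : G, ~~ same_edge a b -> prec a b || prec b a;
  reach_prec : forall a b : G, ~~ same_edge a b -> reach a b -> prec a b;
  planarity : forall a b c : G, reach a b -> prec a c -> prec c b ->
    reach a c || reach c b }.

Record planar_graph := PlanarGraph {
  graph_of :> pregraph;
  graph_planar : planar graph_of }.

Section PlanarTheory.
Context {G : pregraph} (pG : planar G).
Implicit Types a b c h x y : G.

Lemma vtx_refl a : vtx a a.
Proof. by have [] := vtx_equiv pG a a a. Qed.

Lemma vtx_sym a b : vtx a b = vtx b a.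
Proof.
apply/idP/idP => h.
  by have [_ /(_ h) <-] := vtx_equiv pG a b a; exact: vtx_refl.
by have [_ /(_ h) <-] := vtx_equiv pG b a b; exact: vtx_refl.
Qed.

Lemma vtx_trans a b c : vtx a b -> vtx b c -> vtx a c.
Proof. by move=> h1 h2; have [_ /(_ h1) ->] := vtx_equiv pG a b c. Qed.

Lemma se_refl a : same_edge a a. Proof. by rewrite /same_edge eqxx. Qed.

Lemma se_opp a : same_edge a (opp a).
Proof. by rewrite /same_edge eqxx orbT. Qed.

Lemma se_sym a b : same_edge a b = same_edge b a.
Proof.
rewrite /same_edge eq_sym; congr orb.
by apply/eqP/eqP => ->; rewrite (oppK pG).
Qed.

Lemma se_trans a b c : same_edge a b -> same_edge b c -> same_edge a c.
Proof.
rewrite /same_edge => /orP[] /eqP -> // /orP[] /eqP ->; rewrite ?eqxx ?orbT //.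
by rewrite (oppK pG) eqxx.
Qed.

Lemma se_prec_l a b c : same_edge a b -> prec a c = prec b c.
Proof. by case/orP => /eqP -> //; rewrite (prec_oppl pG). Qed.

Lemma se_prec_r a b c : same_edge a b -> prec c a = prec c b.
Proof. by case/orP => /eqP -> //; rewrite (prec_oppr pG). Qed.

Lemma prec_nse a b : prec a b -> ~~ same_edge a b.
Proof. by move=> h; apply/negP => /se_prec_l s; move: h; rewrite s (prec_irr pG). Qed.

Lemma prec_asym a b : prec a b -> ~~ prec b a.
Proof.
move=> h; apply/negP => h'; have := prec_trans pG h h'.
by rewrite (prec_irr pG).
Qed.

Lemma nprec a b : ~~ prec a b -> same_edge a b || prec b a.
Proof.
case: (boolP (same_edge a b)) => //= ns /negbTE n.
by have := prec_total pG ns; rewrite n.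
Qed.

Lemma se_nprec a b : same_edge a b -> ~~ prec a b.
Proof. by move=> s; apply/negP => /prec_nse; rewrite s. Qed.

Lemma nprec_trans a b c : ~~ prec a b -> ~~ prec b c -> ~~ prec a c.
Proof.
move=> /nprec h1 /nprec h2.
case/orP: h1 => h1; first by rewrite (se_prec_l _ h1); case/orP: h2 => [/se_nprec//|/prec_asym//].
case/orP: h2 => h2; first by rewrite -(se_prec_r _ h2) prec_asym.
by apply: prec_asym; apply: (prec_trans pG h2 h1).
Qed.

Lemma se_pos a b : same_edge a b -> pos a = pos b -> a = b.
Proof.
case/orP => /eqP -> //; case: (opp a =P a) => [-> //|/eqP n].
by rewrite (pos_opp pG n); case: (pos a).
Qed.

Lemma virt_opp a : virt (opp a) = virt a.
Proof. by rewrite /virt (oppK pG) eq_sym vtx_sym. Qed.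

Lemma leg_opp a : leg (opp a) = leg a.
Proof. by rewrite /leg virt_opp (oppK pG) eq_sym. Qed.

Lemma virt_vtx a b : virt a -> vtx a b -> virt b.
Proof.
by move=> v /(virtP pG v) /orP[] /eqP -> //; rewrite virt_opp.
Qed.

Lemma mem_osort (A : {set G}) : osort A =i A.
Proof. by move=> x; rewrite mem_sort mem_enum. Qed.

Lemma size_osort (A : {set G}) : size (osort A) = #|A|.
Proof. by rewrite size_sort -cardE. Qed.

Lemma osort_sorted (A : {set G}) (s : bool) :
  {in A, forall x, pos x = s} -> sorted (@prec G) (osort A).
Proof.
move=> hs.
have tot : total (fun a b : G => ~~ prec b a).
  by move=> a b /=; case: (boolP (prec b a)) => //= /prec_asym.
have tr : transitive (fun a b : G => ~~ prec b a).
  by move=> b a c /= h1 h2; apply: nprec_trans h2 h1.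
have st : sorted (fun a b : G => ~~ prec b a) (osort A) by exact: sort_sorted.
have un : uniq (osort A) by rewrite sort_uniq enum_uniq.
rewrite sorted_pairwise in st; last by [].
rewrite uniq_pairwise in un.
apply: pairwise_sorted.
have: pairwise [rel x y | ~~ prec y x && (x != y)] (osort A).
  by rewrite pairwise_relI; apply/andP; split.
apply: (@sub_in_pairwise _ (mem A)) => [x y xA yA /=|]; last first.
  by apply/allP => x; rewrite mem_osort.
move=> /andP[/nprec /orP[e|//] /eqP n]; case: n.
by apply/esym; apply: se_pos e _; rewrite !hs.
Qed.

Lemma step_sel a a' b : same_edge a a' -> step a b = step a' b.
Proof.
move=> s; apply: eq_existsb => x; apply: eq_existsb => y.
congr andb; apply/idP/idP; last exact: se_trans.
by apply: se_trans; rewrite se_sym.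
Qed.

Lemma step_ser a a' b : same_edge a a' -> step b a = step b a'.
Proof.
move=> s; apply: eq_existsb => x; apply: eq_existsb => y.
congr [&& _, _ & _]; congr andb; apply/idP/idP; last exact: se_trans.
by apply: se_trans; rewrite se_sym.
Qed.

Lemma reach_refl a : reach a a.
Proof. by rewrite /reach se_refl. Qed.

Lemma se_reach a b : same_edge a b -> reach a b.
Proof. by rewrite /reach => ->. Qed.

Lemma step_reach a b : step a b -> reach a b.
Proof. by rewrite /reach => /connect1 ->; rewrite orbT. Qed.

Lemma connect_sel a a' b : same_edge a a' -> connect step a b -> reach a' b.
Proof.
move=> s /connectP[[/= _ ->|c p /= /andP[h hp] ->]].
  by apply: se_reach; rewrite se_sym.
rewrite /reach; apply/orP; right; rewrite (step_sel _ s) in h.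
by apply: (connect_trans (connect1 h)); apply/connectP; exists p.
Qed.

Lemma connect_ser a a' b : same_edge a a' -> connect step b a -> reach b a'.
Proof.
move=> s /connectP[p]; elim/last_ind: p => [/= _ e|p c _].
  by apply: se_reach; rewrite -e.
rewrite rcons_path last_rcons => /andP[hp h] e; subst c.
rewrite /reach; apply/orP; right; rewrite (step_ser _ s) in h.
by apply: connect_trans (connect1 h); apply/connectP; exists p.
Qed.

Lemma reach_trans a b c : reach a b -> reach b c -> reach a c.
Proof.
case/orP => h1 /orP[] h2.
- exact: se_reach (se_trans h1 h2).
- by apply: connect_sel h2; rewrite se_sym.
- exact: connect_ser h2 h1.
- by rewrite /reach (connect_trans h1 h2) orbT.
Qed.

Lemma se_reach_l a b c : same_edge a b -> reach a c = reach b c.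
Proof.
move=> s; apply/idP/idP; apply: reach_trans; apply: se_reach => //.
by rewrite se_sym.
Qed.

Lemma se_reach_r a b c : same_edge a b -> reach c a = reach c b.
Proof.
move=> s; apply/idP/idP => h; apply: (reach_trans h); apply: se_reach => //.
by rewrite se_sym.
Qed.

Lemma reach_le a b : reach a b -> same_edge a b || prec a b.
Proof.
by move=> h; case: (boolP (same_edge a b)) => //= n; apply: (reach_prec pG).
Qed.

Lemma stepP a b : step a b -> same_edge a b \/
  exists x y, [/\ same_edge a x, same_edge b y, pos x, ~~ pos y & vtx x y] /\
    ~~ virt x /\ ~~ virt y.
Proof.
move=> /existsP[x /existsP[y /and5P[ax px bY ny v]]].
case: (boolP (virt x)) => [vx|nx].
  left; apply: se_trans ax _; rewrite se_sym; apply: se_trans bY _.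
  by rewrite se_sym; apply: (virtP pG).
right; exists x, y; split; [by split|split=> //].
by apply: contra nx => vy; apply: virt_vtx vy _; rewrite vtx_sym.
Qed.

Lemma vtx_step x y : pos x -> ~~ pos y -> vtx x y -> step x y.
Proof.
move=> px ny v; apply/existsP; exists x; apply/existsP; exists y.
by rewrite !se_refl px ny v.
Qed.

Lemma vtx_prec x y : pos x -> ~~ pos y -> vtx x y -> ~~ virt x -> prec x y.
Proof.
move=> px ny v nv; have := reach_le (step_reach (vtx_step px ny v)).
case/orP => // /orP[] /eqP e; first by move: ny; rewrite e px.
move: nv; rewrite /virt -e v andbT negbK => /eqP e'.
by move: ny; rewrite e' px.
Qed.

Lemma step_in a x : x \in inG G -> step a x -> same_edge a x.
Proof.
rewrite inE => /andP[lx px] /stepP[//|[y [z [[ay xz py nz v] [ny nvz]]]]].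
case/orP: lx => [/eqP e|vx].
  by case/orP: xz => /eqP ez; move: nz; rewrite ez ?e px.
by case/orP: xz => /eqP ez; move: nvz; rewrite ez ?virt_opp vx.
Qed.

Lemma step_out a x : x \in outG G -> step x a -> same_edge x a.
Proof.
rewrite inE => /andP[lx px] /stepP[//|[z [y [[xz ay pz ny v] [nvz nvy]]]]].
case/orP: lx => [/eqP e|vx].
  by case/orP: xz => /eqP ez; move: pz; rewrite ez ?e (negbTE px).
by case/orP: xz => /eqP ez; move: nvz; rewrite ez ?virt_opp vx.
Qed.

Lemma reach_in a x : x \in inG G -> reach a x -> same_edge a x.
Proof.
move=> ix /orP[//|/connectP[p]].
elim: p a => [|b p IH] a /=; first by move=> _ ->; rewrite se_refl.
move=> /andP[h hp] e; have := IH b hp e => s.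
by apply: step_in => //; rewrite -(step_ser _ s).
Qed.

Lemma reach_out a x : x \in outG G -> reach x a -> same_edge x a.
Proof.
move=> ix /orP[//|/connectP[p]].
elim/last_ind: p a => [|p b IH] a /=; first by move=> _ ->; rewrite se_refl.
rewrite rcons_path last_rcons => /andP[hp h] e; subst a.
have s : same_edge x (last x p) by apply: IH.
by apply: step_out => //; rewrite (step_sel _ s).
Qed.

Lemma in_reach c : exists2 i, i \in inG G & reach i c.
Proof.
have [n] := ubnP #|[set x : G | prec x c]|; elim: n c => // n IH c hn.
suff [[i]|[x r p]] : (exists2 i, i \in inG G & same_edge i c) \/
    (exists2 x, reach x c & prec x c).
- by move=> hi /se_reach h; exists i.
- have [|i hi h] := IH x; last by exists i => //; apply: reach_trans h r.
  rewrite -ltnS; apply: leq_trans hn; rewrite ltnS; apply: proper_card; apply/properP; split.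
    by apply/subsetP => y; rewrite !inE => h; apply: (prec_trans pG h p).
  by exists x; rewrite !inE ?p // (prec_irr pG).
have [y cy] : exists2 y, same_edge c y & (leg y && pos y) || (~~ pos y && ~~ virt y).
  case: (boolP (virt c)) => vc.
    case: (boolP (pos c)) => pc; first by exists c; rewrite ?se_refl // /leg vc orbT pc.
    exists (opp c); rewrite ?se_opp // leg_opp /leg vc orbT /=.
    by case/andP: vc => nc _; rewrite (pos_opp pG nc) pc.
  case: (boolP (pos c)) => pc; last by exists c; rewrite ?se_refl // pc vc orbT.
  case: (opp c =P c) => [e|/eqP e].
    by exists c; rewrite ?se_refl // /leg e eqxx pc.
  by exists (opp c); rewrite ?se_opp // virt_opp vc (pos_opp pG e) pc orbT.
case/orP => [h|/andP[ny vy]].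
  by left; exists y; rewrite ?inE // se_sym.
right; have /set0Pn[x] := has_in pG y; rewrite inE => /andP[v px].
rewrite vtx_sym in v.
have nx : ~~ virt x by apply: contra vy => h; apply: virt_vtx h v.
exists x; first by rewrite (se_reach_r _ cy); apply/step_reach/vtx_step.
by rewrite (se_prec_r _ cy); apply: vtx_prec.
Qed.

Lemma out_reach c : exists2 o, o \in outG G & reach c o.
Proof.
have [n] := ubnP #|[set x : G | prec c x]|; elim: n c => // n IH c hn.
suff [[i]|[x r p]] : (exists2 i, i \in outG G & same_edge c i) \/
    (exists2 x, reach c x & prec c x).
- by move=> hi /se_reach h; exists i.
- have [|i hi h] := IH x; last by exists i => //; apply: reach_trans r h.
  rewrite -ltnS; apply: leq_trans hn; rewrite ltnS; apply: proper_card; apply/properP; split.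
    by apply/subsetP => y; rewrite !inE => h; apply: (prec_trans pG p h).
  by exists x; rewrite !inE ?p // (prec_irr pG).
have [y cy] : exists2 y, same_edge c y & (leg y && ~~ pos y) || (pos y && ~~ virt y).
  case: (boolP (virt c)) => vc.
    case: (boolP (pos c)) => pc; last by exists c; rewrite ?se_refl // /leg vc orbT pc.
    exists (opp c); rewrite ?se_opp // leg_opp /leg vc orbT /=.
    by case/andP: vc => nc _; rewrite (pos_opp pG nc) pc.
  case: (boolP (pos c)) => pc; first by exists c; rewrite ?se_refl // pc vc orbT.
  case: (opp c =P c) => [e|/eqP e].
    by exists c; rewrite ?se_refl // /leg e eqxx pc.
  by exists (opp c); rewrite ?se_opp // virt_opp vc (pos_opp pG e) pc orbT.
case/orP => [h|/andP[ny vy]].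
  by left; exists y; rewrite ?inE.
right; have /set0Pn[x] := has_out pG y; rewrite inE => /andP[v px].
exists x; first by rewrite (se_reach_l _ cy); apply/step_reach/vtx_step.
by rewrite (se_prec_l _ cy); apply: vtx_prec.
Qed.

End PlanarTheory.

Lemma osort_map (G G' : pregraph) (f : G -> G') (A : {set G}) (A' : {set G'})
    (s : bool) : planar G -> planar G' ->
  {in A, forall x, pos x = s} -> {in A', forall x, pos x = s} ->
  {in A &, forall x y, prec (f x) (f y) = prec x y} ->
  f @: A = A' -> osort A' = map f (osort A).
Proof.
move=> pG pG' sA sA' hf im.
apply: (irr_sorted_eq (prec_trans pG') (prec_irr pG')).
- exact: (osort_sorted pG' sA').
- rewrite (@sorted_map _ _ f (@prec G')).
  have := osort_sorted pG sA.
  apply: (@sub_in_sorted _ (mem A)) => [x y xA yA /=|]; first by rewrite hf.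
  by apply/allP => x; rewrite mem_osort.
- move=> x; rewrite mem_osort -im.
  by apply/imsetP/mapP => -[y yA ->]; exists y => //; move: yA; rewrite mem_osort.
Qed.

(* Number of elements of A whose edge strictly (resp. weakly) precedes that
   of a; the (k+1)-th element of A in increasing order has [rank] k. *)
Definition rank (G : pregraph) (A : {set G}) (a : G) :=
  #|[set x in A | prec x a]|.
Definition wrank (G : pregraph) (A : {set G}) (a : G) :=
  #|[set x in A | ~~ prec a x]|.

Section RankTheory.
Context {G : pregraph} (pG : planar G) (A : {set G}) (s : bool).
Context (hA : {in A, forall x, pos x = s}).
Implicit Types a b x : G.

Lemma rank_se a b : same_edge a b -> rank A a = rank A b.
Proof.
by move=> h; apply: eq_card => x; rewrite !inE (se_prec_r pG x h).
Qed.

Lemma wrank_se a b : same_edge a b -> wrank A a = wrank A b.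
Proof.
by move=> h; apply: eq_card => x; rewrite !inE (se_prec_l pG x h).
Qed.

Lemma rank_le a b : ~~ prec b a -> rank A a <= rank A b.
Proof.
move=> h; apply/subset_leq_card/subsetP => x; rewrite !inE => /andP[-> p] /=.
case/orP: (nprec pG h) => e; first by rewrite (se_prec_r pG x e).
exact: (prec_trans pG p e).
Qed.

Lemma wrank_le a b : ~~ prec b a -> wrank A a <= wrank A b.
Proof.
move=> h; apply/subset_leq_card/subsetP => x; rewrite !inE => /andP[-> p] /=.
exact: (nprec_trans pG h p).
Qed.

Lemma rank_lt x a : x \in A -> (rank A x < rank A a) = prec x a.
Proof.
move=> xA; case: (boolP (prec x a)) => p; last first.
  by apply/negbTE; rewrite -leqNgt; apply: rank_le.
apply/proper_card/properP; split.
  by apply/subsetP => y; rewrite !inE => /andP[-> q]; apply: (prec_trans pG q p).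
by exists x; rewrite !inE xA ?p // (prec_irr pG).
Qed.

Lemma wrank_lt x a : x \in A -> (wrank A a < wrank A x) = prec a x.
Proof.
move=> xA; case: (boolP (prec a x)) => p; last first.
  by apply/negbTE; rewrite -leqNgt; apply: wrank_le.
apply/proper_card/properP; split.
  apply/subsetP => y; rewrite !inE => /andP[-> q].
  by apply: (nprec_trans pG _ q); apply: prec_asym.
by exists x; rewrite !inE xA ?p ?(prec_irr pG).
Qed.

Lemma wrank_in x : x \in A -> wrank A x = (rank A x).+1.
Proof.
move=> xA; rewrite /wrank (cardsD1 x) inE xA (prec_irr pG) add1n; congr S.
apply: eq_card => y; rewrite !inE.
case: (y =P x) => [->|/eqP n] /=; first by rewrite (prec_irr pG) andbF.
case yA: (y \in A) => //=; apply/idP/idP => h; last by apply: prec_asym.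
case/orP: (nprec pG h) => // e; move/eqP: n; case.
by apply/esym; apply: (se_pos pG e); rewrite !hA.
Qed.

Lemma rank_inj : {in A &, injective (rank A)}.
Proof.
move=> x y xA yA e.
have h : ~~ prec x y by rewrite -rank_lt // e ltnn.
have h' : ~~ prec y x by rewrite -rank_lt // e ltnn.
case/orP: (nprec pG h) => [q|]; last by rewrite (negbTE h').
by apply: (se_pos pG q); rewrite !hA.
Qed.

Lemma rank_card a : rank A a <= #|A|.
Proof. by apply/subset_leq_card/subsetP => x; rewrite inE => /andP[]. Qed.

Lemma wrank_card a : wrank A a <= #|A|.
Proof. by apply/subset_leq_card/subsetP => x; rewrite inE => /andP[]. Qed.

Lemma rank_surj k : k < #|A| -> exists2 x, x \in A & rank A x = k.
Proof.
move=> hk.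
have hb x : x \in A -> rank A x < #|A| by move=> xA; rewrite -wrank_in // wrank_card.
pose f x := rank A x.
have u : uniq (map f (enum A)).
  rewrite map_inj_in_uniq ?enum_uniq // => x y; rewrite !mem_enum; exact: rank_inj.
have sub : {subset map f (enum A) <= iota 0 #|A|}.
  by move=> n /mapP[x]; rewrite mem_enum mem_iota add0n => xA -> /=; apply: hb.
have := uniq_min_size u sub; rewrite size_iota size_map -cardE leqnn => /(_ isT) [_ /(_ k)].
rewrite mem_iota add0n hk /= => /mapP[x]; rewrite mem_enum => xA ->; by exists x.
Qed.

Lemma index_rank x : x \in A -> index x (osort A) = rank A x.
Proof.
move=> xA; have xs : x \in osort A by rewrite mem_osort.
have srt := osort_sorted pG hA.
rewrite sorted_pairwise in srt; last exact: (prec_trans pG).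
have un : uniq (osort A) by rewrite sort_uniq enum_uniq.
have -> : rank A x = #|[set y in take (index x (osort A)) (osort A)]|.
  apply: eq_card => y; rewrite !inE.
  have ys : (y \in osort A) = (y \in A) by rewrite mem_osort.
  rewrite -ys; move: srt un xs; move: (osort A) => l.
  elim: l => //= z l IH /andP[az pl] /andP[zl ul]; rewrite inE.
  case: (z =P x) => [<- _|/eqP n]; rewrite ?eqxx /=.
    rewrite inE; case: (y =P z) => [->|_] /=; first by rewrite (prec_irr pG).
    apply/negP => /andP[/(allP az) h]; by rewrite (negbTE (prec_asym pG h)).
  rewrite eq_sym (negbTE n) /= => xl; rewrite !inE.
  case: (y =P z) => [->|_] /=; first by rewrite (allP az).
  exact: IH.
rewrite cardsE (card_uniqP _) ?take_uniq // size_take.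
by rewrite index_mem xs.
Qed.

End RankTheory.

Section Comp.
Context {G1 G2 : pregraph}.
Implicit Types (x y : G1 + G2).

(* o and i are grafted: o is the k-th element of Out(G1) and i the k-th element
   of In(G2), for the same k. *)
Definition graft (o : G1) (i : G2) :=
  [&& o \in outG G1, i \in inG G2 & rank (outG G1) o == rank (inG G2) i].

(* The edges of a and b are merged into one of the new edges. *)
Definition merged (a : G1) (b : G2) :=
  [exists o, exists i, [&& graft o i, same_edge o a & same_edge i b]].

(* The virtual half-edges which survive are those of virtual edges grafted to
   virtual edges, except for the grafted legs themselves. *)
Definition comp_keep x :=
  match x with
  | inl a => virt a ==> pos a && [exists i, graft (opp a) i && virt i]
  | inr b => virt b ==> ~~ pos b && [exists o, graft o (opp b) && virt o]
  end.

Definition comp_vtx x y :=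
  match x, y with
  | inl a, inl b => vtx a b
  | inr a, inr b => vtx a b
  | inl a, inr b | inr b, inl a => [&& virt a, virt b & merged a b]
  end.

Definition comp_opp x : G1 + G2 :=
  match x with
  | inl a =>
      if virt a then
        if [pick i | graft (opp a) i] is Some i then inr (opp i) else inl a
      else if [pick i | graft a i && ~~ virt i] is Some i then inr i
      else inl (opp a)
  | inr b =>
      if virt b then
        if [pick o | graft o (opp b)] is Some o then inl (opp o) else inr b
      else if [pick o | graft o b && ~~ virt o] is Some o then inl o
      else inr (opp b)
  end.

Definition comp_pos x :=
  match x with inl a => pos a | inr b => pos b end.

(* The order A_1, e_1, B_1, ..., A_n, e_n, B_n: the edges of G1 with k - 1
   elements of Out(G1) strictly before them are those of A_k together with the
   edge becoming e_k, and the edges of G2 with k elements of In(G2) weakly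
   before them are those of B_k together with the edge becoming e_k. *)
Definition comp_prec x y :=
  match x, y with
  | inl a, inl b => prec a b
  | inr a, inr b => prec a b
  | inl a, inr b => (rank (outG G1) a < wrank (inG G2) b) && ~~ merged a b
  | inr b, inl a => wrank (inG G2) b <= rank (outG G1) a
  end.

Definition comp_pregraph : pregraph :=
  @Pregraph {x : G1 + G2 | comp_keep x}
    (fun u v => comp_vtx (val u) (val v))
    (fun u => insubd u (comp_opp (val u)))
    (fun u => comp_pos (val u))
    (fun u v => comp_prec (val u) (val v)).

End Comp.
Arguments comp_pregraph G1 G2 : clear implicits.

Section CompPlanar.
Context {G1 G2 : pregraph} (p1 : planar G1) (p2 : planar G2).
Context (hcard : #|outG G1| = #|inG G2|).
Implicit Types (a o : G1) (b i : G2) (x y z : G1 + G2).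

Let r1 := rank (outG G1).
Let r2 := rank (inG G2).
Let w2 := wrank (inG G2).

Lemma posO : {in outG G1, forall o, pos o = false}.
Proof. by move=> o; rewrite inE => /andP[_ /negbTE]. Qed.

Lemma posI : {in inG G2, forall i, pos i = true}.
Proof. by move=> o; rewrite inE => /andP[_ ->]. Qed.

Lemma graftP o i : graft o i -> [/\ o \in outG G1, i \in inG G2 & r1 o = r2 i].
Proof. by case/and3P => -> -> /eqP. Qed.

Lemma graft_w o i : graft o i -> w2 i = (r1 o).+1.
Proof. by case/graftP => oO iI ->; rewrite /w2 (wrank_in p2 posI). Qed.

Lemma graft_injl o o' i : graft o i -> graft o' i -> o = o'.
Proof.
move=> /graftP[oO iI e] /graftP[oO' _ e'].
by apply: (rank_inj p1 posO) => //; rewrite -/r1 e e'.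
Qed.

Lemma graft_injr o i i' : graft o i -> graft o i' -> i = i'.
Proof.
move=> /graftP[oO iI e] /graftP[_ iI' e'].
by apply: (rank_inj p2 posI) => //; rewrite -/r2 -e -e'.
Qed.

Lemma graft_ex k : k < #|outG G1| -> exists o i, graft o i /\ r1 o = k.
Proof.
move=> hk; have [o oO eo] := rank_surj p1 posO hk.
have [i iI ei] := rank_surj p2 posI (etrans (esym (congr1 (leq k.+1) hcard)) hk).
by exists o, i; split; first apply/and3P; rewrite ?oO ?iI ?eo ?ei.
Qed.

Lemma graft_exl o : o \in outG G1 -> exists i, graft o i.
Proof.
move=> oO; have hk : r1 o < #|outG G1|.
  by rewrite /r1 -(wrank_in p1 posO) // wrank_card.
have [o' [i [g e]]] := graft_ex hk; exists i.
have [oO' _ _] := graftP g.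
by rewrite -(rank_inj p1 posO oO' oO e).
Qed.

Lemma graft_exr i : i \in inG G2 -> exists o, graft o i.
Proof.
move=> iI; have hk : r2 i < #|outG G1|.
  by rewrite hcard /r2 -(wrank_in p2 posI) // wrank_card.
have [o [i' [g e]]] := graft_ex hk; exists o.
have [_ iI' e'] := graftP g.
by rewrite -(rank_inj p2 posI iI' iI) // -/r2 -e'.
Qed.

Lemma mergedP a b :
  reflect (exists o i, [/\ graft o i, same_edge o a & same_edge i b]) (merged a b).
Proof.
apply: (iffP existsP) => [[o /existsP[i /and3P[]]]|[o [i []]] g h h'].
  by exists o, i.
by exists o; apply/existsP; exists i; rewrite g h h'.
Qed.

Lemma graft_merged o i : graft o i -> merged o i.
Proof. by move=> g; apply/mergedP; exists o, i; rewrite !se_refl. Qed.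

Definition ceq x y :=
  match x, y with
  | inl a, inl b => same_edge a b
  | inr a, inr b => same_edge a b
  | inl a, inr b | inr b, inl a => merged a b
  end.

Lemma mergedE o i a b : graft o i -> same_edge o a -> merged a b = same_edge i b.
Proof.
move=> g s; apply/idP/idP => [/mergedP[o' [i' [g' s' t']]]|t]; last first.
  by apply/mergedP; exists o, i.
have e : o' = o.
  have [oO _ _] := graftP g; have [oO' _ _] := graftP g'.
  apply: (se_pos p1); last by rewrite !posO.
  by apply: (se_trans p1 s'); rewrite se_sym.
by rewrite e in g'; rewrite (graft_injr g g').
Qed.

Lemma mergedE' o i a b : graft o i -> same_edge i b -> merged a b = same_edge o a.
Proof.
move=> g s; apply/idP/idP => [/mergedP[o' [i' [g' s' t']]]|t]; last first.
  by apply/mergedP; exists o, i.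
have e : i' = i.
  have [_ iI _] := graftP g; have [_ iI' _] := graftP g'.
  apply: (se_pos p2); last by rewrite !posI.
  by apply: (se_trans p2 t'); rewrite se_sym.
by rewrite e in g'; rewrite (graft_injl g g').
Qed.

Lemma merged_sel a a' b : same_edge a a' -> merged a b = merged a' b.
Proof.
move=> s; apply/mergedP/mergedP => -[o [i [g h h']]]; exists o, i; split=> //.
  exact: (se_trans p1 h s).
by apply: (se_trans p1 h); rewrite se_sym.
Qed.

Lemma merged_ser a b b' : same_edge b b' -> merged a b = merged a b'.
Proof.
move=> s; apply/mergedP/mergedP => -[o [i [g h h']]]; exists o, i; split=> //.
  exact: (se_trans p2 h' s).
by apply: (se_trans p2 h'); rewrite se_sym.
Qed.

Lemma ceq_refl x : ceq x x.
Proof. by case: x => c /=; rewrite se_refl. Qed.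

Lemma ceq_sym x y : ceq x y = ceq y x.
Proof. by case: x y => c [] d //=; rewrite se_sym. Qed.

Lemma ceq_trans x y z : ceq x y -> ceq y z -> ceq x z.
Proof.
case: x y z => a [] b [] c //=.
- exact: se_trans.
- by move=> s; rewrite (merged_sel _ s).
- move=> /mergedP[o [i [g s s']]]; rewrite (mergedE' _ g s').
  by apply: se_trans => //; rewrite se_sym.
- by move=> m s; rewrite -(merged_ser _ s).
- by move=> m s; rewrite -(merged_sel _ s).
- move=> /mergedP[o [i [g s s']]]; rewrite (mergedE _ g s).
  by apply: se_trans => //; rewrite se_sym.
- by move=> s; rewrite (merged_ser _ s).
- exact: se_trans.
Qed.

Lemma lt_w a o i : graft o i -> (r1 a < w2 i) = ~~ prec o a.
Proof.
move=> g; have [oO _ _] := graftP g.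
by rewrite (graft_w g) ltnS -(rank_lt p1 a oO) -leqNgt.
Qed.

Lemma le_w a o i : graft o i -> (w2 i <= r1 a) = prec o a.
Proof. by move=> g; rewrite leqNgt (lt_w _ g) negbK. Qed.

Lemma lt_r b o i : graft o i -> (r1 o < w2 b) = ~~ prec b i.
Proof.
move=> g; have [_ iI e] := graftP g.
by rewrite -(wrank_lt p2 b iI) -leqNgt -/w2 (graft_w g).
Qed.

Lemma le_r b o i : graft o i -> (w2 b <= r1 o) = prec b i.
Proof. by move=> g; rewrite leqNgt (lt_r _ g) negbK. Qed.

Lemma npse1 a o : ~~ prec o a && ~~ same_edge o a = prec a o.
Proof.
apply/andP/idP => [[h n]|h].
  by case/orP: (nprec p1 h) => //; rewrite (negbTE n).
by split; [apply: prec_asym | rewrite se_sym //; apply: prec_nse].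
Qed.

Lemma npse2 b i : ~~ prec b i && ~~ same_edge i b = prec i b.
Proof.
apply/andP/idP => [[h n]|h].
  by case/orP: (nprec p2 h) => //; rewrite se_sym // (negbTE n).
by split; [apply: prec_asym | apply: prec_nse].
Qed.

Lemma cprec_merged a b z : merged a b ->
  (comp_prec (inl a) z = comp_prec (inr b) z) *
  (comp_prec z (inl a) = comp_prec z (inr b)).
Proof.
move=> /mergedP[o [i [g s s']]].
have ra : rank (outG G1) a = r1 o by rewrite -(rank_se p1 _ s).
have wb : wrank (inG G2) b = w2 i by rewrite -(wrank_se p2 _ s').
case: z => c; split => /=.
- by rewrite wb (le_w _ g) (se_prec_l p1 _ s).
- by rewrite wb (lt_w _ g) (mergedE' _ g s') npse1 (se_prec_r p1 _ s).
- by rewrite ra (lt_r _ g) (mergedE _ g s) npse2 (se_prec_l p2 _ s').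
- by rewrite ra (le_r _ g) (se_prec_r p2 _ s').
Qed.

Lemma cprec_ceq x y z : ceq x y ->
  (comp_prec x z = comp_prec y z) * (comp_prec z x = comp_prec z y).
Proof.
case: x y => a [] b /=.
- move=> s; case: z => c /=; split.
  + by rewrite (se_prec_l p1 _ s).
  + by rewrite (se_prec_r p1 _ s).
  + by rewrite (rank_se p1 _ s) (merged_sel _ s).
  + by rewrite (rank_se p1 _ s).
- exact: cprec_merged.
- by move=> /(cprec_merged z)[e1 e2]; split; apply/esym.
- move=> s; case: z => c /=; split.
  + by rewrite (wrank_se p2 _ s).
  + by rewrite (wrank_se p2 _ s) (merged_ser _ s).
  + by rewrite (se_prec_l p2 _ s).
  + by rewrite (se_prec_r p2 _ s).
Qed.

Lemma cprec_irr x : comp_prec x x = false.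
Proof. by case: x => c /=; rewrite prec_irr. Qed.

Lemma cprec_nceq x y : comp_prec x y -> ~~ ceq x y.
Proof. by move=> p; apply/negP => /(cprec_ceq y) [e _]; move: p; rewrite e cprec_irr. Qed.

Lemma cprec_trans : transitive (@comp_prec G1 G2).
Proof.
move=> y x z; case: x y z => a [] b [] c //=.
- exact: prec_trans.
- move=> h /andP[h' m]; apply/andP; split.
    by apply: leq_ltn_trans h'; apply: rank_le => //; apply: prec_asym.
  apply/negP => m'; have [_ /=] := cprec_merged (inl b) m'.
  rewrite (negbTE (prec_asym p1 h)) h' m /= => //.
- move=> /andP[h m] h'; rewrite -[prec a c]negbK; apply/negP => n.
  by have := leq_ltn_trans (leq_trans h' (rank_le p1 (outG G1) n)) h; rewrite ltnn.
- move=> /andP[h m] h'; apply/andP; split.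
    by apply: leq_trans h _; apply: wrank_le => //; apply: prec_asym.
  apply/negP => m'; have [/= + _] := cprec_merged (inr b) m'.
  by rewrite h m (negbTE (prec_asym p2 h')).
- move=> h h'; apply: (leq_trans h); apply: rank_le => //; exact: prec_asym.
- move=> h /andP[h' m]; rewrite -[prec a c]negbK; apply/negP => n.
  have := leq_ltn_trans (leq_trans (wrank_le p2 (inG G2) n) h) h'; by rewrite ltnn.
- move=> h h'; apply: leq_trans h'; apply: wrank_le => //; exact: prec_asym.
- exact: prec_trans.
Qed.

Lemma cprec_total x y : ~~ ceq x y -> comp_prec x y || comp_prec y x.
Proof.
case: x y => a [] b /=.
- exact: prec_total.
- by move=> ->; rewrite andbT; case: ltnP.
- by move=> ->; rewrite andbT; case: leqP.
- exact: prec_total.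
Qed.

Definition arr x y :=
  match x, y with
  | inl a, inl b => reach a b
  | inr a, inr b => reach a b
  | inl a, inr b => [exists o, exists i, [&& graft o i, reach a o & reach i b]]
  | inr b, inl a => merged a b
  end.

Lemma arrP a b :
  reflect (exists o i, [/\ graft o i, reach a o & reach i b]) (arr (inl a) (inr b)).
Proof.
apply: (iffP existsP) => [[o /existsP[i /and3P[]]]|[o [i []]] g h h'].
  by exists o, i.
by exists o; apply/existsP; exists i; rewrite g h h'.
Qed.

Lemma ceq_arr x y : ceq x y -> arr x y.
Proof.
case: x y => a [] b //=; try exact: se_reach.
move=> /mergedP[o [i [g s s']]]; apply/arrP; exists o, i.
by split=> //; apply: se_reach => //; rewrite se_sym.
Qed.

Lemma arr_trans x y z : arr x y -> arr y z -> arr x z.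
Proof.
case: x y z => a [] b [] c.
- exact: reach_trans.
- move=> h /arrP[o [i [g r r']]]; apply/arrP; exists o, i; split=> //.
  exact: reach_trans h r.
- move=> /arrP[o [i [g r r']]] /= /mergedP[o' [i' [g' s s']]].
  have [_ iI' _] := graftP g'; have [_ iI _] := graftP g.
  have h : reach i i' by rewrite (se_reach_r p2 i s').
  have e : i = i' by apply: (se_pos p2 (reach_in p2 iI' h)); rewrite !posI.
  subst i'; rewrite (graft_injl g' g) in s.
  by apply: (reach_trans p1 r); apply: se_reach.
- move=> /arrP[o [i [g r r']]] h; apply/arrP; exists o, i; split=> //.
  exact: reach_trans h.
- move=> /= /mergedP[o [i [g s s']]] h; apply/mergedP; exists o, i; split=> //.
  have [oO _ _] := graftP g.
  by apply: reach_out => //; rewrite (se_reach_l p1 _ s).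
- move=> /= /mergedP[o [i [g s s']]] /arrP[o' [i' [g' r r']]].
  have [oO _ _] := graftP g; have [oO' _ _] := graftP g'.
  have h : reach o o' by rewrite (se_reach_l p1 _ s).
  have e : o = o' by apply: (se_pos p1 (reach_out p1 oO h)); rewrite !posO.
  subst o'; rewrite (graft_injr g' g) in r'.
  by apply: reach_trans r' => //; apply: se_reach => //; rewrite se_sym.
- move=> /= h /mergedP[o [i [g s s']]]; apply/mergedP; exists o, i; split=> //.
  have [_ iI _] := graftP g.
  rewrite se_sym //; apply: reach_in => //; by rewrite (se_reach_r p2 _ s').
- exact: reach_trans.
Qed.

Lemma arr_le x y : arr x y -> ceq x y || comp_prec x y.
Proof.
case: x y => a [] b.
- exact: reach_le.
- move=> /arrP[o [i [g r r']]] /=; case: (boolP (merged a b)) => //= m; rewrite andbT.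
  have [oO iI _] := graftP g.
  have l1 : r1 a <= r1 o.
    by apply: rank_le => //; case/orP: (reach_le p1 r) => [s|/prec_asym->//];
       apply: se_nprec => //; rewrite se_sym.
  have l2 : w2 i <= w2 b.
    by apply: wrank_le => //; case/orP: (reach_le p2 r') => [s|/prec_asym->//];
       apply: se_nprec => //; rewrite se_sym.
  by apply: (leq_ltn_trans l1); apply: leq_trans l2; rewrite (graft_w g).
- by move=> /= ->.
- exact: reach_le.
Qed.

Lemma first_out a o i : graft o i -> r1 a = r1 o -> reach a o.
Proof.
move=> g e; have [oO _ _] := graftP g.
have no : ~~ prec o a by rewrite -(rank_lt p1 a oO) -/r1 e ltnn.
case/orP: (nprec p1 no) => [s|ao]; first by apply: se_reach; rewrite se_sym.
have [o' oO' r] := out_reach p1 a.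
case: (o' =P o) => [<- //|/eqP n].
have ao' : ~~ prec o' a.
  case/orP: (reach_le p1 r) => h; last exact: (prec_asym p1).
  by apply: (se_nprec p1); rewrite se_sym.
have oo' : prec o o'.
  have h : ~~ prec o' o.
    rewrite -(rank_lt p1 _ oO') -/r1 -e (rank_lt p1 a oO') //.
  case/orP: (nprec p1 h) => // s; case/eqP: n.
  by apply: (se_pos p1 s); rewrite !posO.
case/orP: (planarity p1 r ao oo') => // /(reach_out p1 oO) s.
by move: (prec_nse p1 oo'); rewrite s.
Qed.

Lemma last_in b o i : graft o i -> w2 b = w2 i -> reach i b.
Proof.
move=> g e; have [_ iI _] := graftP g.
have nb : ~~ prec b i by rewrite -(wrank_lt p2 b iI) -/w2 e ltnn.
case/orP: (nprec p2 nb) => [s|ib].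
  by apply: se_reach => //; rewrite se_sym.
have [i' iI' r] := in_reach p2 b.
case: (i' =P i) => [<- //|/eqP n].
have bi' : ~~ prec b i'.
  case/orP: (reach_le p2 r) => h; last exact: (prec_asym p2).
  by apply: (se_nprec p2); rewrite se_sym.
have ii' : prec i' i.
  have h : ~~ prec i i'.
    by rewrite -(wrank_lt p2 _ iI') -/w2 -e (wrank_lt p2 b iI').
  case/orP: (nprec p2 h) => // s; case/eqP: n.
  by apply: (se_pos p2); rewrite ?posI // se_sym.
case/orP: (planarity p2 r ii' ib) => // /(reach_in p2 iI) s.
by move: (prec_nse p2 ii'); rewrite s.
Qed.

Lemma out_anti o o' : o \in outG G1 -> prec o o' -> ~~ reach o o'.
Proof. by move=> oO /(prec_nse p1) n; apply: contra n => /(reach_out p1 oO). Qed.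

Lemma in_anti i i' : i' \in inG G2 -> prec i i' -> ~~ reach i i'.
Proof. by move=> iI /(prec_nse p2) n; apply: contra n => /(reach_in p2 iI). Qed.

Lemma arr_planar x y z : arr x y -> comp_prec x z -> comp_prec z y ->
  arr x z || arr z y.
Proof.
case: x y z => a [] b [] c.
- exact: planarity.
- move=> /= r /andP[l1 m1] l2.
  have k : (w2 c).-1 < #|outG G1|.
    by rewrite hcard; apply: leq_trans (wrank_card _ c); rewrite prednK // (leq_ltn_trans _ l1).
  have [o [i [g e]]] := graft_ex k.
  have wc : w2 c = w2 i by rewrite (graft_w g) e prednK // (leq_ltn_trans _ l1).
  have [oO _ _] := graftP g.
  have ob : prec o b by rewrite -(rank_lt p1 b oO) -/r1 -(graft_w g) -wc.
  have ao : ~~ prec o a by rewrite -(lt_w _ g) -wc.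
  apply/orP; left; apply/existsP; exists o; apply/existsP; exists i.
  rewrite g (last_in g wc) andbT /=.
  case/orP: (nprec p1 ao) => [s|ao']; first by apply: se_reach; rewrite se_sym.
  by case/orP: (planarity p1 r ao' ob) => //; rewrite (negbTE (out_anti oO ob)).
- move=> /arrP[o [i [g r r']]] /= ac /andP[l m].
  have [oO iI e] := graftP g.
  case: (boolP (prec o c)) => [oc|no]; last first.
    case/orP: (nprec p1 no) => [s|co].
      by rewrite -(se_reach_r p1 _ s) r.
    case/orP: (planarity p1 r ac co) => [->//|h].
    by apply/orP; right; apply/existsP; exists o; apply/existsP; exists i; rewrite g h r'.
  have k : r1 c < #|outG G1| by rewrite hcard; apply: leq_trans (wrank_card _ b).
  have [o' [i' [g' e']]] := graft_ex k.
  have [oO' iI' e''] := graftP g'.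
  apply/orP; right; apply/existsP; exists o'; apply/existsP; exists i'.
  rewrite g' (first_out g' (esym e')) /=.
  have ii' : prec i i'.
    rewrite -(rank_lt p2 _ iI) -/r2 -e -e'' e'; by rewrite /r1 (rank_lt p1).
  have bi' : ~~ prec b i'.
    by rewrite -(lt_r _ g') e'.
  case/orP: (nprec p2 bi') => [s|i'b]; first by apply: se_reach; rewrite se_sym.
  by case/orP: (planarity p2 r' ii' i'b) => // h; move: (in_anti iI' ii'); rewrite h.
- move=> /arrP[o [i [g r r']]] /= /andP[l m] cb.
  have [oO iI e] := graftP g.
  case: (boolP (prec c i)) => [ci|nc]; last first.
    case/orP: (nprec p2 nc) => [s|ic].
      by rewrite (se_reach_l p2 _ s) r' orbT.
    case/orP: (planarity p2 r' ic cb) => [h|->]; last by rewrite orbT.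
    by apply/orP; left; apply/existsP; exists o; apply/existsP; exists i; rewrite g r h.
  have k : (w2 c).-1 < #|outG G1|.
    by rewrite hcard; apply: leq_trans (wrank_card _ c); rewrite prednK // (leq_ltn_trans _ l).
  have [o' [i' [g' e']]] := graft_ex k.
  have wc : w2 c = w2 i' by rewrite (graft_w g') e' prednK // (leq_ltn_trans _ l).
  have [oO' iI' _] := graftP g'.
  apply/orP; left; apply/existsP; exists o'; apply/existsP; exists i'.
  rewrite g' (last_in g' wc) andbT /=.
  have oo' : prec o' o.
    rewrite -(rank_lt p1 _ oO') -/r1 -(graft_w g') -wc.
    by rewrite -ltnS -(graft_w g) /w2 (wrank_lt p2).
  have ao' : ~~ prec o' a by rewrite -(lt_w _ g') -wc.
  case/orP: (nprec p1 ao') => [s|ao'']; first by apply: se_reach; rewrite se_sym.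
  by case/orP: (planarity p1 r ao'' oo') => // h; move: (out_anti oO' oo'); rewrite h.
- move=> m p q; have := cprec_trans p q.
  by have [<- _] := cprec_merged (inl b) m; rewrite cprec_irr.
- move=> m p q; have := cprec_trans p q.
  by have [<- _] := cprec_merged (inl b) m; rewrite cprec_irr.
- move=> /= r l1 /andP[l2 m].
  have k : r1 c < #|outG G1| by rewrite hcard; apply: leq_trans (wrank_card _ b).
  have [o [i [g e]]] := graft_ex k; have [oO iI _] := graftP g.
  apply/orP; right; apply/existsP; exists o; apply/existsP; exists i.
  rewrite g (first_out g (esym e)) /=.
  have ai : prec a i by rewrite -(le_r _ g) e.
  have bi : ~~ prec b i by rewrite -(lt_r _ g) e.
  case/orP: (nprec p2 bi) => [s|ib]; first by apply: se_reach; rewrite se_sym.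
  by case/orP: (planarity p2 r ai ib) => // h; move: (in_anti iI ai); rewrite h.
- exact: planarity.
Qed.

Let C := comp_pregraph G1 G2.
Implicit Types u v w : C.

Lemma leg_virt_out o : virt o -> pos o -> opp o \in outG G1.
Proof.
move=> vo po; rewrite inE leg_opp // /leg vo orbT /=.
by case/andP: vo => n _; rewrite (pos_opp p1 n) po.
Qed.

Lemma virt_negI i : virt i -> ~~ pos i -> opp i \in inG G2.
Proof.
move=> vo po; rewrite inE leg_opp // /leg vo orbT /=.
by case/andP: vo => n _; rewrite (pos_opp p2 n) (negbTE po).
Qed.

Lemma real_leg1 o i : graft o i -> ~~ virt o -> opp o = o.
Proof. by case/graftP; rewrite inE /leg => /andP[/orP[/eqP//|->]]. Qed.

Lemma real_leg2 o i : graft o i -> ~~ virt i -> opp i = i.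
Proof. by case/graftP => _; rewrite inE /leg => /andP[/orP[/eqP//|->]]. Qed.

Variant opp_spec_l a : G1 + G2 -> Type :=
| OppLVirt i of virt a & pos a & graft (opp a) i & virt i :
    opp_spec_l a (inr (opp i))
| OppLReal i of ~~ virt a & graft a i & ~~ virt i : opp_spec_l a (inr i)
| OppLIn of ~~ virt a & (forall i, graft a i -> virt i) :
    opp_spec_l a (inl (opp a)).

Lemma opplP a : comp_keep (G2 := G2) (inl a) -> opp_spec_l a (comp_opp (inl a)).
Proof.
rewrite /=; case: (boolP (virt a)) => [va /=|nva _].
  move=> /andP[pa /existsP h].
  case: pickP => [i g|n]; last by exfalso; case: h => i /andP[]; rewrite n.
  apply: OppLVirt => //; case: h => i' /andP[g' v].
  by rewrite (graft_injr g g').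
case: pickP => [i /andP[g nv]|n]; first exact: OppLReal.
by apply: OppLIn => // i g; move: (n i); rewrite g => /negbFE.
Qed.

Variant opp_spec_r b : G1 + G2 -> Type :=
| OppRVirt o of virt b & ~~ pos b & graft o (opp b) & virt o :
    opp_spec_r b (inl (opp o))
| OppRReal o of ~~ virt b & graft o b & ~~ virt o : opp_spec_r b (inl o)
| OppRIn of ~~ virt b & (forall o, graft o b -> virt o) :
    opp_spec_r b (inr (opp b)).

Lemma opprP b : comp_keep (G1 := G1) (inr b) -> opp_spec_r b (comp_opp (inr b)).
Proof.
rewrite /=; case: (boolP (virt b)) => [va /=|nva _].
  move=> /andP[pa /existsP h].
  case: pickP => [i g|n]; last by exfalso; case: h => i /andP[]; rewrite n.
  apply: OppRVirt => //; case: h => i' /andP[g' v].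
  by rewrite (graft_injl g g').
case: pickP => [i /andP[g nv]|n]; first exact: OppRReal.
by apply: OppRIn => // i g; move: (n i); rewrite g => /negbFE.
Qed.

Lemma keepl a i : virt a -> pos a -> graft (opp a) i -> virt i ->
  comp_keep (G2 := G2) (inl a).
Proof.
by move=> va pa g vi; rewrite /= va pa /=; apply/existsP; exists i; rewrite g.
Qed.

Lemma keepr b o : virt b -> ~~ pos b -> graft o (opp b) -> virt o ->
  comp_keep (G1 := G1) (inr b).
Proof.
by move=> va pa g vi; rewrite /= va pa /=; apply/existsP; exists o; rewrite g.
Qed.

Lemma graft_neg o i : graft o i -> virt o -> pos (opp o).
Proof. by case/graftP => oO _ _ /andP[n _]; rewrite (pos_opp p1 n) posO. Qed.

Lemma graft_pos o i : graft o i -> virt i -> ~~ pos (opp i).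
Proof. by case/graftP => _ iI _ /andP[n _]; rewrite (pos_opp p2 n) posI. Qed.

Lemma copp_keep x : comp_keep x -> comp_keep (comp_opp x).
Proof.
case: x => [a|b] h.
- case: (opplP h) => [i va pa g vi|i na g ni|na _] /=.
  + apply: (@keepr (opp i) (opp a)); rewrite ?virt_opp ?(oppK p2) //.
    exact: graft_pos g vi.
  + by rewrite (negbTE ni).
  + by rewrite virt_opp // (negbTE na).
- case: (opprP h) => [o vb pb g vo|o nb g no|nb _] /=.
  + apply: (@keepl (opp o) (opp b)); rewrite ?virt_opp ?(oppK p1) //.
    exact: graft_neg g vo.
  + by rewrite (negbTE no).
  + by rewrite virt_opp // (negbTE nb).
Qed.

Lemma copp_ceq x : comp_keep x -> ceq x (comp_opp x).
Proof.
case: x => [a|b] h.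
- case: (opplP h) => [i va pa g vi|i na g ni|na _] /=.
  + by apply/mergedP; exists (opp a), i; split=> //; rewrite ?se_opp // se_sym // se_opp.
  + exact: graft_merged.
  + exact: se_opp.
- case: (opprP h) => [o vb pb g vo|o nb g no|nb _] /=.
  + by apply/mergedP; exists o, (opp b); split=> //; rewrite ?se_opp // se_sym // se_opp.
  + exact: graft_merged.
  + exact: se_opp.
Qed.

Lemma val_opp u : val (opp u) = comp_opp (val u).
Proof. by rewrite /= val_insubd copp_keep // (valP u). Qed.

Lemma ceq_opp x y : comp_keep x -> comp_keep y -> ceq x y ->
  y = x \/ y = comp_opp x.
Proof.
case: x y => a [] b kx ky; rewrite [ceq _ _]/=.
- case/orP => /eqP e; subst b; first by left.
  case: (opplP kx) => [i va pa g vi|i na g ni|na _]; last by right.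
    move: ky; rewrite /= virt_opp // va /=; case/andP: va => n _.
    by rewrite (pos_opp p1 n) pa.
  by left; rewrite (real_leg1 g na).
- move=> /mergedP[o [i [g s t]]]; have [oO iI _] := graftP g.
  case: (opplP kx) => [i' va pa g' vi'|i' na g' ni|na hi].
  + have e : a = opp o.
      by case/orP: s => /eqP // e; move: pa; rewrite e posO.
    move: g'; rewrite e (oppK p1) => g'; have ei := graft_injr g' g; subst i'.
    case/orP: t => /eqP et; last by right; rewrite et.
    by move: ky; rewrite et /= vi' posI.
  + have no : ~~ virt o by move: na; case/orP: s => /eqP -> //; rewrite virt_opp.
    have e : a = o by case/orP: s => /eqP -> //; apply: real_leg1 g no.
    move: g'; rewrite e => g'; have ei := graft_injr g' g; subst i'.
    have ei := real_leg2 g ni.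
    by right; case/orP: t => /eqP ->; rewrite ?ei.
  + have no : ~~ virt o by move: na; case/orP: s => /eqP -> //; rewrite virt_opp.
    have e : a = o by case/orP: s => /eqP -> //; apply: real_leg1 g no.
    subst a; have vi := hi _ g.
    have vb : virt b by case/orP: t => /eqP -> //; rewrite virt_opp.
    move: ky; rewrite /= vb => /andP[pb /existsP[o' /andP[g' v']]].
    have eb : b = opp i by case/orP: t => /eqP // eb; move: pb; rewrite eb posI.
    move: g'; rewrite eb (oppK p2) => g'; move: no.
    by rewrite (graft_injl g g') v'.
- move=> /mergedP[o [i [g s t]]]; have [oO iI _] := graftP g.
  case: (opprP kx) => [o' va pa g' vi'|o' na g' ni|na hi].
  + have e : a = opp i.
      by case/orP: t => /eqP // e; move: pa; rewrite e posI.
    move: g'; rewrite e (oppK p2) => g'; have ei := graft_injl g' g; subst o'.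
    case/orP: s => /eqP et; last by right; rewrite et.
    by move: ky; rewrite et /= vi' posO.
  + have no : ~~ virt i by move: na; case/orP: t => /eqP -> //; rewrite virt_opp.
    have e : a = i by case/orP: t => /eqP -> //; apply: real_leg2 g no.
    move: g'; rewrite e => g'; have ei := graft_injl g' g; subst o'.
    have ei := real_leg1 g ni.
    by right; case/orP: s => /eqP ->; rewrite ?ei.
  + have no : ~~ virt i by move: na; case/orP: t => /eqP -> //; rewrite virt_opp.
    have e : a = i by case/orP: t => /eqP -> //; apply: real_leg2 g no.
    subst a; have vi := hi _ g.
    have vb : virt b by case/orP: s => /eqP -> //; rewrite virt_opp.
    move: ky; rewrite /= vb => /andP[pb /existsP[o' /andP[g' v']]].
    have eb : b = opp o by case/orP: s => /eqP // eb; move: pb; rewrite eb posO.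
    move: g'; rewrite eb (oppK p1) => g'; move: no.
    by rewrite (graft_injr g g') v'.
- case/orP => /eqP e; subst b; first by left.
  case: (opprP kx) => [i va pa g vi|i na g ni|na _]; last by right.
    move: ky; rewrite /= virt_opp // va /=; case/andP: va => n _.
    by rewrite (pos_opp p2 n) (negbTE pa).
  by left; rewrite (real_leg2 g na).
Qed.

Lemma se_ceq u v : same_edge u v = ceq (val u) (val v).
Proof.
apply/idP/idP => [/orP[]/eqP ->|h]; first exact: ceq_refl.
  by rewrite val_opp; apply: copp_ceq; apply: (valP u).
apply/orP; have [e|e] := ceq_opp (valP u) (valP v) h.
  by left; apply/eqP/val_inj.
by right; apply/eqP/val_inj; rewrite e val_opp.
Qed.

Lemma copp_invol x : comp_keep x -> comp_opp (comp_opp x) = x.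
Proof.
case: x => [a|b] h; have := copp_keep h.
- case: (opplP h) => [i va pa g vi|i na g ni|na hi] h'.
  + case: (opprP h') => [o vb pb g' vo|o nb|nb].
    * by move: g'; rewrite (oppK p2) => /(graft_injl g) <-; rewrite (oppK p1).
    * by rewrite virt_opp // vi in nb.
    * by rewrite virt_opp // vi in nb.
  + case: (opprP h') => [o vb|o nb g' no|nb hi].
    * by rewrite vb in ni.
    * by rewrite (graft_injl g g').
    * by move: na; rewrite (hi _ g).
  + case: (opplP h') => [i va|i _ g ni|_ _]; last by rewrite (oppK p1).
    * by move: va na; rewrite virt_opp // => ->.
    * have [oO _ _] := graftP g.
      move: oO; rewrite inE leg_opp // => /andP[/orP[/eqP e|v]]; last by rewrite v in na.
      by rewrite e in g; move: ni; rewrite (hi _ g).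
- case: (opprP h) => [o vb pb g vo|o nb g no|nb hi] h'.
  + case: (opplP h') => [i va pa g' vi|i na|na].
    * by move: g'; rewrite (oppK p1) => /(graft_injr g) <-; rewrite (oppK p2).
    * by rewrite virt_opp // vo in na.
    * by rewrite virt_opp // vo in na.
  + case: (opplP h') => [i va|i na g' ni|na hi].
    * by rewrite va in no.
    * by rewrite (graft_injr g g').
    * by move: nb; rewrite (hi _ g).
  + case: (opprP h') => [o vb|o _ g no|_ _]; last by rewrite (oppK p2).
    * by move: vb nb; rewrite virt_opp // => ->.
    * have [_ iI _] := graftP g.
      move: iI; rewrite inE leg_opp // => /andP[/orP[/eqP e|v]]; last by rewrite v in nb.
      by rewrite e in g; move: no; rewrite (hi _ g).
Qed.

Lemma copp_pos x : comp_keep x -> comp_opp x != x ->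
  comp_pos (comp_opp x) = ~~ comp_pos x.
Proof.
case: x => [a|b] h.
- case: (opplP h) => [i va pa g vi _|i na g ni _|na _ e] /=.
  + by rewrite pa (negbTE (graft_pos g vi)).
  + by have [oO iI _] := graftP g; rewrite posO ?posI.
  + by apply: (pos_opp p1); apply: contra e => /eqP ->.
- case: (opprP h) => [i va pa g vi _|i na g ni _|na _ e] /=.
  + by rewrite pa (graft_neg g vi).
  + by have [oO iI _] := graftP g; rewrite posO ?posI.
  + by apply: (pos_opp p2); apply: contra e => /eqP ->.
Qed.

Definition comp_virt x := match x with inl a => virt a | inr b => virt b end.

Lemma virtC u : virt u = comp_virt (val u).
Proof.
rewrite /virt -(inj_eq val_inj) -[vtx u _]/(comp_vtx (val u) (val (opp u))) val_opp.
have := valP u; case: (val u) => [a|b] h.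
- case: (opplP h) => [i va pa g vi|i na g ni|na _] /=.
  + rewrite va virt_opp // vi /=; apply/mergedP; exists (opp a), i; split=> //.
      by rewrite se_sym ?se_opp.
    exact: se_opp.
  + by rewrite (negbTE na).
  + rewrite (negbTE na); apply/negbTE; apply: contra na => /andP[n v].
    by rewrite /virt v andbT; apply: contra n => /eqP ->.
- case: (opprP h) => [i va pa g vi|i na g ni|na _] /=.
  + rewrite va virt_opp // vi /=; apply/mergedP; exists i, (opp b); split=> //.
      exact: se_opp.
    by rewrite se_sym ?se_opp.
  + by rewrite (negbTE na) andbF.
  + rewrite (negbTE na); apply/negbTE; apply: contra na => /andP[n v].
    by rewrite /virt v andbT; apply: contra n => /eqP ->.
Qed.

Lemma merged_vtx1 a b (c : G1) : virt a -> merged a b -> merged c b -> vtx a c.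
Proof.
move=> va m m'.
have : ceq (inl a) (inl c) by apply: (@ceq_trans _ (inr b)).
by case/orP => /eqP ->; [apply: vtx_refl | case/andP: va].
Qed.

Lemma merged_vtx2 a b (c : G2) : virt b -> merged a b -> merged a c -> vtx b c.
Proof.
move=> va m m'.
have : ceq (inr b) (inr c) by apply: (@ceq_trans _ (inl a)).
by case/orP => /eqP ->; [apply: vtx_refl | case/andP: va].
Qed.

Lemma cvtx_refl x : comp_vtx x x.
Proof. by case: x => c /=; apply: vtx_refl. Qed.

Lemma cvtx_sym x y : comp_vtx x y = comp_vtx y x.
Proof. by case: x y => a [] b //=; apply: vtx_sym. Qed.

Lemma cvtx_trans x y z : comp_vtx x y -> comp_vtx y z -> comp_vtx x z.
Proof.
case: x y z => a [] b [] c /=.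
- exact: vtx_trans.
- move=> v /and3P[vb vc m]; have va : virt a by apply: virt_vtx vb _ => //; rewrite vtx_sym.
  by rewrite va vc /= (merged_sel _ (virtP p1 va v)).
- by move=> /and3P[va vb m] /and3P[vc _ m']; apply: merged_vtx1 va m m'.
- move=> /and3P[va vb m] v; rewrite va (virt_vtx p2 vb v) /=.
  by rewrite -(merged_ser _ (virtP p2 vb v)).
- move=> /and3P[vb va m] v; rewrite va (virt_vtx p1 vb v) /=.
  by rewrite -(merged_sel _ (virtP p1 vb v)).
- by move=> /and3P[va vb m] /and3P[_ vc m']; apply: (merged_vtx2 vb m m').
- move=> v /and3P[vc vb m]; have va : virt a by apply: virt_vtx vb _ => //; rewrite vtx_sym.
  by rewrite va vc /= (merged_ser _ (virtP p2 va v)).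
- exact: vtx_trans.
Qed.

Lemma real_keepl a : ~~ virt a -> comp_keep (G2 := G2) (inl a).
Proof. by move=> n; rewrite /= (negbTE n). Qed.

Lemma real_keepr b : ~~ virt b -> comp_keep (G1 := G1) (inr b).
Proof. by move=> n; rewrite /= (negbTE n). Qed.

Lemma kept_rep o i : graft o i -> exists w : C, ceq (inl o) (val w).
Proof.
move=> g; case: (boolP (virt o)) => vo; last first.
  by exists (Sub _ (real_keepl vo)); rewrite SubK ceq_refl.
case: (boolP (virt i)) => vi; last first.
  by exists (Sub _ (real_keepr vi)); rewrite SubK; apply: graft_merged.
have h : comp_keep (G2 := G2) (inl (opp o)).
  by apply: (@keepl _ i); rewrite ?virt_opp ?(oppK p1) //; apply: graft_neg g vo.
by exists (Sub _ h); rewrite SubK; apply: se_opp.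
Qed.

Lemma ceq_reach u v : ceq (val u) (val v) -> reach u v.
Proof. by move=> h; rewrite /reach se_ceq h. Qed.

Lemma step_ceq u v (x y : C) : ceq (val u) (val x) -> ceq (val v) (val y) ->
  pos x -> ~~ pos y -> comp_vtx (val x) (val y) -> step u v.
Proof.
move=> h h' px ny vxy; apply/existsP; exists x; apply/existsP; exists y.
by rewrite !se_ceq h h' px ny; exact: vxy.
Qed.

Lemma step_arr u v : step u v -> arr (val u) (val v).
Proof.
move=> /existsP[x /existsP[y /and5P[ux px vy ny]]].
rewrite se_ceq in ux; rewrite se_ceq ceq_sym in vy => vxy.
apply: (arr_trans (ceq_arr ux)); apply: arr_trans (ceq_arr vy) => {ux vy}.
move: px ny vxy => /=; case: (val x) (val y) => a [] b /= px ny.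
- by move=> w; apply/step_reach/vtx_step.
- by case/and3P => _ _ m; apply: (@ceq_arr (inl a) (inr b)).
- by case/and3P => _ _ m; apply: (@ceq_arr (inr a) (inl b)).
- by move=> w; apply/step_reach/vtx_step.
Qed.

Lemma reach_arr u v : reach u v -> arr (val u) (val v).
Proof.
case/orP => [|/connectP[p]]; first by rewrite se_ceq => /ceq_arr.
elim: p u => [u _ ->|w p IH u /= /andP[h hp] e]; first exact/ceq_arr/ceq_refl.
exact: arr_trans (step_arr h) (IH _ hp e).
Qed.

Lemma reach_trC u v w : reach u v -> reach v w -> reach u w.
Proof.
have ser (x y z : C) : same_edge x y -> connect step y z -> reach x z.
  move=> s /connectP[[/= _ -> //|c p /= /andP[h hp] ->]]; first by rewrite /reach s.
  rewrite /reach; apply/orP; right; apply: (@connect_trans _ _ c).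
    apply: connect1; move: h => /existsP[a /existsP[b /and5P[ya pa cb nb vab]]].
    rewrite se_ceq in s; rewrite se_ceq in ya; rewrite se_ceq in cb.
    apply: (@step_ceq x c a b) => //.
    exact: ceq_trans s ya.
  by apply/connectP; exists p.
have sel (x y z : C) : connect step x y -> same_edge y z -> reach x z.
  move=> /connectP[p]; elim/last_ind: p => [/= _ -> h|p c _].
    by rewrite /reach h.
  rewrite rcons_path last_rcons => /andP[hp h] e s; subst c.
  rewrite /reach; apply/orP; right; apply: (@connect_trans _ _ (last x p)).
    by apply/connectP; exists p.
  apply: connect1; move: h => /existsP[a /existsP[b /and5P[ya pa cb nb vab]]].
  rewrite se_ceq in s; rewrite se_ceq in ya; rewrite se_ceq in cb.
  apply: (@step_ceq _ z a b) => //.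
  by apply: ceq_trans cb; rewrite ceq_sym.
case/orP => h1 /orP[] h2.
- by rewrite /reach se_ceq (@ceq_trans _ (val v)) // -se_ceq.
- exact: ser h1 h2.
- exact: sel h1 h2.
- by rewrite /reach (connect_trans h1 h2) orbT.
Qed.

Lemma lift_l (a b : G1) u v : reach a b -> ceq (val u) (inl a) -> ceq (inl b) (val v) ->
  reach u v.
Proof.
case/orP => [s h h'|/connectP[p]].
  by apply: ceq_reach; apply: ceq_trans (ceq_trans h _) h'.
elim: p a u => [a u _ -> h h'|c p IH a u /= /andP[h hp] e hu hv].
  by apply: ceq_reach; apply: ceq_trans h h'.
have [s|[x [y [[ax cy px ny xy] [nx nny]]]]] := stepP p1 h.
  by apply: (IH c) => //; apply: ceq_trans hu _.
pose X : C := Sub _ (real_keepl nx); pose Y : C := Sub _ (real_keepl nny).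
apply: (@reach_trC u Y).
  apply/orP; right; apply: connect1; apply: (@step_ceq u Y X Y) => //.
  - by apply: ceq_trans hu _.
  - exact: ceq_refl.
by apply: (IH c) => //=; rewrite se_sym.
Qed.

Lemma lift_r (a b : G2) u v : reach a b -> ceq (val u) (inr a) -> ceq (inr b) (val v) ->
  reach u v.
Proof.
case/orP => [s h h'|/connectP[p]].
  by apply: ceq_reach; apply: ceq_trans (ceq_trans h _) h'.
elim: p a u => [a u _ -> h h'|c p IH a u /= /andP[h hp] e hu hv].
  by apply: ceq_reach; apply: ceq_trans h h'.
have [s|[x [y [[ax cy px ny xy] [nx nny]]]]] := stepP p2 h.
  by apply: (IH c) => //; apply: ceq_trans hu _.
pose X : C := Sub _ (real_keepr nx); pose Y : C := Sub _ (real_keepr nny).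
apply: (@reach_trC u Y).
  apply/orP; right; apply: connect1; apply: (@step_ceq u Y X Y) => //.
  - by apply: ceq_trans hu _.
  - exact: ceq_refl.
by apply: (IH c) => //=; rewrite se_sym.
Qed.

Lemma arr_reach u v : arr (val u) (val v) -> reach u v.
Proof.
case eu: (val u) => [a|a]; case ev: (val v) => [b|b].
- by move=> h; apply: (lift_l h); rewrite ?eu ?ev ceq_refl.
- move=> /arrP[o [i [g r r']]]; have [w hw] := kept_rep g.
  apply: (@reach_trC _ w).
    by apply: (lift_l r) => //; rewrite eu ceq_refl.
  apply: (lift_r r'); last by rewrite ev ceq_refl.
  by rewrite ceq_sym; apply: ceq_trans hw; apply: graft_merged.
- by move=> h; apply: ceq_reach; rewrite eu ev.
- by move=> h; apply: (lift_r h); rewrite ?eu ?ev ceq_refl.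
Qed.

Lemma comp_in u : inV u != set0.
Proof.
apply/set0Pn; have := valP u; case eu: (val u) => [a|b] k.
- case: (boolP (virt a)) => va.
    exists u; rewrite inE /= eu cvtx_refl /=.
    by move: k; rewrite /= va => /andP[].
  have /set0Pn[x] := has_in p1 a; rewrite inE => /andP[v px].
  have nx : ~~ virt x by apply: contra va => h; apply: virt_vtx h _ => //; rewrite vtx_sym.
  by exists (Sub _ (real_keepl nx)); rewrite inE /= eu /= v px.
- case: (boolP (virt b)) => vb.
    exists (opp u); have vu : virt u by rewrite virtC eu.
    have /andP[n vv] := vu; rewrite inE vv /=.
    rewrite -[insubd _ _]/(opp u) val_opp copp_pos ?(valP u) //.
      by rewrite eu /=; move: k; rewrite /= vb => /andP[].
    by rewrite -val_opp (inj_eq val_inj).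
  have /set0Pn[x] := has_in p2 b; rewrite inE => /andP[v px].
  have nx : ~~ virt x by apply: contra vb => h; apply: virt_vtx h _ => //; rewrite vtx_sym.
  by exists (Sub _ (real_keepr nx)); rewrite inE /= eu /= v px.
Qed.

Lemma comp_out u : outV u != set0.
Proof.
apply/set0Pn; have := valP u; case eu: (val u) => [b|a] k.
- case: (boolP (virt b)) => vb.
    exists (opp u); have vu : virt u by rewrite virtC eu.
    have /andP[n vv] := vu; rewrite inE vv /=.
    rewrite -[insubd _ _]/(opp u) val_opp copp_pos ?(valP u) //.
      by rewrite eu /=; move: k; rewrite /= vb negbK => /andP[].
    by rewrite -val_opp (inj_eq val_inj).
  have /set0Pn[x] := has_out p1 b; rewrite inE => /andP[v px].
  have nx : ~~ virt x by apply: contra vb => h; apply: virt_vtx h _ => //; rewrite vtx_sym.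
  by exists (Sub _ (real_keepl nx)); rewrite inE /= eu /= v px.
- case: (boolP (virt a)) => va.
    exists u; rewrite inE /= eu cvtx_refl /=.
    by move: k; rewrite /= va => /andP[].
  have /set0Pn[x] := has_out p2 a; rewrite inE => /andP[v px].
  have nx : ~~ virt x by apply: contra va => h; apply: virt_vtx h _ => //; rewrite vtx_sym.
  by exists (Sub _ (real_keepr nx)); rewrite inE /= eu /= v px.
Qed.

Lemma comp_planar : planar C.
Proof.
split.
- move=> x y z; split; first exact: cvtx_refl.
  move=> h; apply/idP/idP; last exact: cvtx_trans.
  by apply: cvtx_trans; rewrite cvtx_sym.
- by move=> u; apply: val_inj; rewrite !val_opp copp_invol ?(valP u).
- move=> u v; rewrite virtC se_ceq /=; case: (val u) (val v) => a [] b /=.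
  + exact: virtP.
  + by move=> _ /and3P[].
  + by move=> _ /and3P[].
  + exact: virtP.
- move=> u; rewrite -(inj_eq val_inj) val_opp => h.
  by rewrite -copp_pos ?(valP u) // -val_opp.
- exact: comp_in.
- exact: comp_out.
- move=> u v; rewrite -[LHS]/(comp_prec (val (opp u)) (val v)) val_opp.
  by have [<- _] := cprec_ceq (val v) (copp_ceq (valP u)).
- move=> u v; rewrite -[LHS]/(comp_prec (val u) (val (opp v))) val_opp.
  by have [_ <-] := cprec_ceq (val u) (copp_ceq (valP v)).
- by move=> u; apply: cprec_irr.
- by move=> v u w; apply: cprec_trans.
- by move=> u v; rewrite se_ceq; apply: cprec_total.
- move=> u v; rewrite se_ceq => n /reach_arr /arr_le; by rewrite (negbTE n).
- move=> u v w /reach_arr r h h'; apply/orP.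
  by case/orP: (arr_planar r h h') => /arr_reach; [left|right].
Qed.

End CompPlanar.

Lemma osort_eq (G : pregraph) (A : {set G}) (s : bool) (l : seq G) :
  planar G -> {in A, forall x, pos x = s} ->
  sorted (@prec G) l -> l =i A -> osort A = l.
Proof.
move=> pG hs srt e; apply: (irr_sorted_eq (prec_trans pG) (prec_irr pG)) => //.
  exact: (osort_sorted pG hs).
by move=> x; rewrite e mem_osort.
Qed.

Definition sum_pregraph (G1 G2 : pregraph) : pregraph :=
  @Pregraph (G1 + G2)%type
    (fun x y => match x, y with
                | inl a, inl b => vtx a b
                | inr a, inr b => vtx a b
                | _, _ => false end)
    (fun x => match x with inl a => inl (opp a) | inr b => inr (opp b) end)
    (fun x => match x with inl a => pos a | inr b => pos b end)
    (fun x y => match x, y with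
                | inl a, inl b => prec a b
                | inr a, inr b => prec a b
                | inl _, inr _ => true
                | inr _, inl _ => false end).

Section SumPlanar.
Context {G1 G2 : pregraph} (p1 : planar G1) (p2 : planar G2).
Let S := sum_pregraph G1 G2.
Implicit Types u v w : S.

Lemma sum_se_l (a b : G1) : same_edge (inl a : S) (inl b) = same_edge a b.
Proof. by []. Qed.

Lemma sum_se_r (a b : G2) : same_edge (inr a : S) (inr b) = same_edge a b.
Proof. by []. Qed.

Lemma sum_virt_l (a : G1) : virt (inl a : S) = virt a.
Proof. by []. Qed.

Lemma sum_virt_r (a : G2) : virt (inr a : S) = virt a.
Proof. by []. Qed.

Lemma sum_step u v : step u v = match u, v with
  | inl a, inl b => step a b | inr a, inr b => step a b | _, _ => false end.
Proof.
case: u v => a [] b.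
- apply/idP/idP.
    move=> /existsP[[] x /existsP[[] y /and5P[] //]] *.
    by apply/existsP; exists x; apply/existsP; exists y; apply/and5P.
  move=> /existsP[x /existsP[y h]].
  by apply/existsP; exists (inl x); apply/existsP; exists (inl y).
- by apply/negbTE/negP => /existsP[[] x /existsP[[] y /and5P[]]].
- by apply/negbTE/negP => /existsP[[] x /existsP[[] y /and5P[]]].
- apply/idP/idP.
    move=> /existsP[[] x /existsP[[] y /and5P[] //]] *.
    by apply/existsP; exists x; apply/existsP; exists y; apply/and5P.
  move=> /existsP[x /existsP[y h]].
  by apply/existsP; exists (inr x); apply/existsP; exists (inr y).
Qed.

Lemma sum_reach u v : reach u v = match u, v with
  | inl a, inl b => reach a b | inr a, inr b => reach a b | _, _ => false end.
Proof.
apply/idP/idP.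
- case/orP => [|/connectP[p]].
    by case: u v => a [] b //=; rewrite /reach ?sum_se_l ?sum_se_r => ->.
  elim: p u => [u _ ->|w p IH u /= /andP[h hp] e].
    by case: u => a; apply: reach_refl.
  have := IH w hp e; move: h; rewrite sum_step.
  by case: u v w {IH hp e} => a [] b [] c // /step_reach; apply: reach_trans.
- case: u v => a [] b // /orP[s|/connectP[p]]; rewrite /reach ?sum_se_l ?sum_se_r ?s //.
    move=> hp ->; apply/orP; right; elim: p a hp => //= c p IH a /andP[h hp].
    apply: (connect_trans _ (IH _ hp)); apply: connect1; by rewrite sum_step.
  move=> hp ->; apply/orP; right; elim: p a hp => //= c p IH a /andP[h hp].
  apply: (connect_trans _ (IH _ hp)); apply: connect1; by rewrite sum_step.
Qed.

Lemma sum_planar : planar S.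
Proof.
split.
- move=> u v w; split; first by case: u v w => a [] b [] c /=; apply: vtx_refl.
  case: u v w => a [] b [] c //= h; apply/idP/idP; apply: vtx_trans => //;
    by rewrite vtx_sym.
- by case=> a /=; rewrite oppK.
- by case=> a [] b //; [apply: (virtP p1)|apply: (virtP p2)].
- by case=> a h /=; apply: pos_opp => //; apply: contra h => /eqP e; rewrite /= e.
- case=> a; apply/set0Pn; [have /set0Pn[x] := has_in p1 a|have /set0Pn[x] := has_in p2 a];
    rewrite inE => h; [exists (inl x)|exists (inr x)]; by rewrite inE.
- case=> a; apply/set0Pn; [have /set0Pn[x] := has_out p1 a|have /set0Pn[x] := has_out p2 a];
    rewrite inE => h; [exists (inl x)|exists (inr x)]; by rewrite inE.
- by case=> a [] b //=; rewrite prec_oppl.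
- by case=> a [] b //=; rewrite prec_oppr.
- by case=> a /=; rewrite prec_irr.
- by case=> a [] b [] c //=; apply: prec_trans.
- by case=> a [] b //=; rewrite ?sum_se_l ?sum_se_r; apply: prec_total.
- by case=> a [] b //=; rewrite ?sum_se_l ?sum_se_r sum_reach //; apply: reach_prec.
- by case=> a [] b [] c //=; rewrite !sum_reach //; apply: planarity.
Qed.

End SumPlanar.

Definition prime_pregraph (m n : nat) : pregraph :=
  @Pregraph ('I_m + 'I_n)%type (fun _ _ => true) id
    (fun x => match x with inl _ => true | inr _ => false end)
    (fun x y => match x, y with
                | inl i, inl j => i < j
                | inr i, inr j => i < j
                | inl _, inr _ => true
                | inr _, inl _ => false end).

Lemma prime_planar m n : 0 < m -> 0 < n -> planar (prime_pregraph m n).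
Proof.
move=> hm hn; set P := prime_pregraph m n.
have se (x y : P) : same_edge x y = (y == x) by rewrite /same_edge orbb.
have st (x y : P) : step x y -> pos x /\ ~~ pos y.
  by move=> /existsP[a /existsP[b /and5P[]]]; rewrite !se => /eqP -> ? /eqP ->.
have re (x y : P) : reach x y -> x = y \/ pos x /\ ~~ pos y.
  case/orP => [|/connectP[[_ ->|c [|d p] /=]]]; first by rewrite se => /eqP ->; left.
  - by left.
  - by rewrite andbT => /st h ->; right.
  - by move=> /and3P[/st[_ h] /st[h']]; rewrite h' in h.
have re' (x y : P) : pos x -> ~~ pos y -> reach x y.
  move=> px py; apply/orP; right; apply: connect1.
  by apply/existsP; exists x; apply/existsP; exists y; rewrite !se !eqxx px py.
split=> //.
- by move=> h h'; rewrite /virt eqxx.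
- by move=> h; rewrite eqxx.
- by move=> h; apply/set0Pn; exists (inl (Ordinal hm)); rewrite inE.
- by move=> h; apply/set0Pn; exists (inr (Ordinal hn)); rewrite inE.
- by case=> i /=; rewrite ltnn.
- by case=> i [] j [] k //= h h'; apply: ltn_trans h h'.
- by case=> i [] j //; rewrite se /= => n0; rewrite -neq_ltn;
  apply: contra n0 => /eqP /ord_inj ->.
- move=> x y; rewrite se => n' /re[e|]; first by rewrite e eqxx in n'.
  by case: x y {n'} => i [] j [].
- move=> x y z /re[<-|[px py]] h h'.
    by move: h h'; case: x z => i [] j //= h /(ltn_trans h); rewrite ltnn.
  by case pz: (pos z); [rewrite (re' z y) ?pz ?orbT | rewrite (re' x z) ?pz].
Qed.

(* The unitary graph: one virtual edge, forming one virtual vertex, whose half-edge of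
   sign + is [true]. *)
Definition unit_pregraph : pregraph :=
  @Pregraph bool (fun _ _ => true) negb id (fun _ _ => false).

Lemma unit_planar : planar unit_pregraph.
Proof.
have se (x y : unit_pregraph) : same_edge x y by case: x y => [] [].
split=> //.
- by case.
- by move=> h; apply/set0Pn; exists true; rewrite inE.
- by move=> h; apply/set0Pn; exists false; rewrite inE.
- by move=> x y; rewrite se.
- by move=> x y; rewrite se.
Qed.

Definition empty_pregraph : pregraph :=
  @Pregraph void (fun _ _ => true) id (fun _ => true) (fun _ _ => false).

Lemma empty_planar : planar empty_pregraph.
Proof. by split=> -[]. Qed.

Record tensor_scheme := TensorScheme {
  Ob : Type;
  Mor : Type;
  src : Mor -> seq Ob;
  tgt : Mor -> seq Ob;
  src_gt0 : forall f, 0 < size (src f);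
  tgt_gt0 : forall f, 0 < size (tgt f) }.

Record scheme_mor (D E : tensor_scheme) := SchemeMor {
  mob : Ob D -> Ob E;
  mmor : Mor D -> Mor E;
  src_mmor : forall f, src (mmor f) = map mob (src f);
  tgt_mmor : forall f, tgt (mmor f) = map mob (tgt f) }.

(* The map from real vertices to morphisms is given by [dmor], which sends a
   half-edge to the decoration of its vertex if that is real, and to [None]
   otherwise. *)
Record diagram (D : tensor_scheme) := Diagram {
  dgraph :> planar_graph;
  dob : dgraph -> Ob D;
  dmor : dgraph -> option (Mor D);
  dob_opp : forall h, dob (opp h) = dob h;
  dmor_vtx : forall h h', vtx h h' -> dmor h = dmor h';
  dmor_real : forall h, dmor h = ~~ virt h :> bool;
  dmor_src : forall h f, dmor h = Some f ->
    src f = [seq dob x | x <- osort (inV h)];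
  dmor_tgt : forall h f, dmor h = Some f ->
    tgt f = [seq dob x | x <- osort (outV h)] }.

Definition dom D (A : diagram D) : seq (Ob D) :=
  [seq dob x | x <- osort (inG A)].

Definition cod D (A : diagram D) : seq (Ob D) :=
  [seq dob x | x <- osort (outG A)].

Definition diso D (A B : diagram D) : Prop :=
  exists f : A -> B,
    [/\ bijective f,
        forall x y, vtx (f x) (f y) = vtx x y,
        forall x, f (opp x) = opp (f x),
        forall x, pos (f x) = pos x &
        forall x y, prec (f x) (f y) = prec x y] /\
    (forall x, dob (f x) = dob x) /\ (forall x, dmor (f x) = dmor x).

Definition prime_label (T : Type) (s t : seq T)
    (x : 'I_(size s) + 'I_(size t)) : T :=
  match x with inl i => tnth (in_tuple s) i | inr j => tnth (in_tuple t) j end.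

Lemma prime_sorted (T : Type) (s t : seq T) (hs : 0 < size s) (ht : 0 < size t)
    (P := prime_pregraph (size s) (size t)) :
  map (@prime_label T s t) (osort [set x : P | pos x]) = s /\
  map (@prime_label T s t) (osort [set x : P | ~~ pos x]) = t.
Proof.
have pP := prime_planar hs ht.
have en n : sorted [rel i j : 'I_n | i < j] (enum 'I_n).
  by have := iota_ltn_sorted 0 n; rewrite -val_enum_ord sorted_map.
split.
  rewrite (@osort_eq P _ true (map inl (enum 'I_(size s)))) //.
  - by rewrite -map_comp; exact: (map_tnth_enum (in_tuple s)).
  - by move=> x; rewrite inE.
  - by rewrite sorted_map; apply: en.
  - by case=> i; rewrite inE; [rewrite map_f ?mem_enum | apply/mapP => -[]].
rewrite (@osort_eq P _ false (map inr (enum 'I_(size t)))) //.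
- by rewrite -map_comp; exact: (map_tnth_enum (in_tuple t)).
- by move=> x; rewrite inE => /negbTE.
- by rewrite sorted_map; apply: en.
- by case=> i; rewrite inE; [apply/mapP => -[] | rewrite map_f ?mem_enum].
Qed.

Section Diagrams.
Context {D : tensor_scheme}.
Implicit Types A B : diagram D.

Section Prime.
Context (f : Mor D).
Let P := PlanarGraph (prime_planar (src_gt0 f) (tgt_gt0 f)).
Let lab : P -> Ob D := @prime_label _ (src f) (tgt f).

Lemma prime_real (h : P) : Some f = ~~ virt h :> bool.
Proof. by rewrite /virt eqxx. Qed.

Lemma prime_inV (h : P) : inV h = [set x | pos x].
Proof. by apply/setP => x; rewrite !inE. Qed.

Lemma prime_outV (h : P) : outV h = [set x | ~~ pos x].
Proof. by apply/setP => x; rewrite !inE. Qed.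

Lemma prime_src (h : P) (g : Mor D) : Some f = Some g ->
  src g = [seq lab x | x <- osort (inV h)].
Proof.
by case=> <-; rewrite prime_inV;
   case: (prime_sorted (src_gt0 f) (tgt_gt0 f)) => /esym.
Qed.

Lemma prime_tgt (h : P) (g : Mor D) : Some f = Some g ->
  tgt g = [seq lab x | x <- osort (outV h)].
Proof.
by case=> <-; rewrite prime_outV;
   case: (prime_sorted (src_gt0 f) (tgt_gt0 f)) => _ /esym.
Qed.

Definition prime_diagram : diagram D :=
  @Diagram D P lab (fun _ => Some f) (fun _ => erefl) (fun _ _ _ => erefl)
    prime_real prime_src prime_tgt.

Lemma dom_prime : dom prime_diagram = src f.
Proof.
rewrite /dom (_ : inG _ = [set x : P | pos x]).
  by case: (prime_sorted (src_gt0 f) (tgt_gt0 f)).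
by apply/setP => x; rewrite !inE /leg eqxx.
Qed.

Lemma cod_prime : cod prime_diagram = tgt f.
Proof.
rewrite /cod (_ : outG _ = [set x : P | ~~ pos x]).
  by case: (prime_sorted (src_gt0 f) (tgt_gt0 f)).
by apply/setP => x; rewrite !inE /leg eqxx.
Qed.

End Prime.

Section Unit.
Context (x : Ob D).
Let U := PlanarGraph unit_planar.

Lemma unit_real (h : U) : (None : option (Mor D)) = ~~ virt h :> bool.
Proof. by case: h. Qed.

Lemma unit_none (g : Mor D) (P : Prop) : None = Some g -> P.
Proof. by []. Qed.

Definition unit_diagram : diagram D :=
  @Diagram D U (fun _ => x) (fun _ => None) (fun _ => erefl)
    (fun _ _ _ => erefl) unit_real
    (fun _ g => @unit_none g _) (fun _ g => @unit_none g _).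

Lemma dom_unit : dom unit_diagram = [:: x].
Proof.
rewrite /dom (@osort_eq U _ true [:: true]) //; first exact: unit_planar.
  by move=> h; rewrite inE => /andP[].
by case; rewrite !inE.
Qed.

Lemma cod_unit : cod unit_diagram = [:: x].
Proof.
rewrite /cod (@osort_eq U _ false [:: false]) //; first exact: unit_planar.
  by move=> h; rewrite inE => /andP[_ /negbTE].
by case; rewrite !inE.
Qed.

End Unit.

Definition empty_diagram : diagram D.
Proof.
by refine (@Diagram D (PlanarGraph empty_planar)
  (fun h => match h with end) (fun h => match h with end) _ _ _ _ _); case.
Defined.

Lemma dom_empty : dom empty_diagram = [::].
Proof. by rewrite /dom; case: (osort _) => [|[]]. Qed.

Lemma cod_empty : cod empty_diagram = [::].
Proof. by rewrite /cod; case: (osort _) => [|[]]. Qed.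

Section Tensor.
Context (A B : diagram D).
Let pA := graph_planar A.
Let pB := graph_planar B.
Let S := PlanarGraph (sum_planar pA pB).

Definition tensor_ob (x : S) : Ob D :=
  match x with inl a => dob a | inr b => dob b end.
Definition tensor_mor (x : S) : option (Mor D) :=
  match x with inl a => dmor a | inr b => dmor b end.

Lemma tensor_opp x : tensor_ob (opp x) = tensor_ob x.
Proof. by case: x => a /=; apply: dob_opp. Qed.

Lemma tensor_vtx x y : vtx x y -> tensor_mor x = tensor_mor y.
Proof. by case: x y => a [] b //=; apply: dmor_vtx. Qed.

Lemma tensor_real x : tensor_mor x = ~~ virt x :> bool.
Proof. by case: x => a /=; rewrite dmor_real. Qed.

Lemma tensor_osort_l (X : {set A}) (Y : {set S}) s :
  {in X, forall x, pos x = s} -> (@inl A B) @: X = Y ->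
  osort Y = map inl (osort X).
Proof.
move=> hX e; apply: (@osort_map A S inl X Y s) => //; first exact: sum_planar.
by rewrite -e => _ /imsetP[x xX ->]; apply: hX.
Qed.

Lemma tensor_osort_r (X : {set B}) (Y : {set S}) s :
  {in X, forall x, pos x = s} -> (@inr A B) @: X = Y ->
  osort Y = map inr (osort X).
Proof.
move=> hX e; apply: (@osort_map B S inr X Y s) => //; first exact: sum_planar.
by rewrite -e => _ /imsetP[x xX ->]; apply: hX.
Qed.

Lemma imset_inl (X : {set A}) (Y : {set S}) :
  (forall a, (inl a \in Y) = (a \in X)) -> (forall b, inr b \notin Y) ->
  (@inl A B) @: X = Y.
Proof.
move=> h h'; apply/setP => -[] c.
  by rewrite h mem_imset // => ? ? [].
by rewrite (negbTE (h' c)); apply/imsetP => -[].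
Qed.

Lemma imset_inr (X : {set B}) (Y : {set S}) :
  (forall a, (inr a \in Y) = (a \in X)) -> (forall b, inl b \notin Y) ->
  (@inr A B) @: X = Y.
Proof.
move=> h h'; apply/setP => -[] c.
  by rewrite (negbTE (h' c)); apply/imsetP => -[].
by rewrite h mem_imset // => ? ? [].
Qed.

Lemma tensor_src x f : tensor_mor x = Some f ->
  src f = [seq tensor_ob y | y <- osort (inV x)].
Proof.
case: x => a /= /dmor_src ->.
- rewrite (@tensor_osort_l (inV a) _ true); first by rewrite -map_comp.
    by move=> x; rewrite inE => /andP[].
  by apply: imset_inl => b; rewrite !inE.
- rewrite (@tensor_osort_r (inV a) _ true); first by rewrite -map_comp.
    by move=> x; rewrite inE => /andP[].
  by apply: imset_inr => b; rewrite !inE.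
Qed.

Lemma tensor_tgt x f : tensor_mor x = Some f ->
  tgt f = [seq tensor_ob y | y <- osort (outV x)].
Proof.
case: x => a /= /dmor_tgt ->.
- rewrite (@tensor_osort_l (outV a) _ false); first by rewrite -map_comp.
    by move=> x; rewrite inE => /andP[_ /negbTE].
  by apply: imset_inl => b; rewrite !inE.
- rewrite (@tensor_osort_r (outV a) _ false); first by rewrite -map_comp.
    by move=> x; rewrite inE => /andP[_ /negbTE].
  by apply: imset_inr => b; rewrite !inE.
Qed.

Definition tensor : diagram D :=
  @Diagram D S tensor_ob tensor_mor tensor_opp tensor_vtx tensor_real
    tensor_src tensor_tgt.

Lemma sum_osort (X : {set A}) (Y : {set B}) (Z : {set S}) s :
  {in X, forall x, pos x = s} -> {in Y, forall x, pos x = s} ->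
  (forall a, (inl a \in Z) = (a \in X)) -> (forall b, (inr b \in Z) = (b \in Y)) ->
  osort Z = map inl (osort X) ++ map inr (osort Y).
Proof.
move=> hX hY eX eY; apply: (@osort_eq S _ s); first exact: sum_planar.
- by case=> c; rewrite ?eX ?eY; [apply: hX | apply: hY].
- apply: pairwise_sorted; rewrite pairwise_cat !pairwise_map.
  have tr (G : pregraph) (pG : planar G) (V : {set G}) :
      {in V, forall x, pos x = s} -> pairwise (@prec G) (osort V).
    by move=> h; rewrite -sorted_pairwise ?(osort_sorted pG h) //; apply: prec_trans.
  apply/and3P; split; [|exact: (tr A)|exact: (tr B)].
  by apply/allrelP => _ _ /mapP[a _ ->] /mapP[b _ ->].
- case=> c; rewrite mem_cat ?eX ?eY.
  + rewrite mem_map ?mem_osort; last by move=> ? ? [].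
    by rewrite orbC (_ : _ \in _ = false) //; apply/mapP => -[].
  + rewrite orbC mem_map ?mem_osort; last by move=> ? ? [].
    by rewrite orbC (_ : _ \in _ = false) //; apply/mapP => -[].
Qed.

Lemma dom_tensor : dom tensor = dom A ++ dom B.
Proof.
rewrite /dom (@sum_osort (inG A) (inG B) _ true).
- by rewrite map_cat -!map_comp.
- by move=> x; rewrite inE => /andP[].
- by move=> x; rewrite inE => /andP[].
- by move=> x; rewrite !inE.
- by move=> x; rewrite !inE.
Qed.

Lemma cod_tensor : cod tensor = cod A ++ cod B.
Proof.
rewrite /cod (@sum_osort (outG A) (outG B) _ false).
- by rewrite map_cat -!map_comp.
- by move=> x; rewrite inE => /andP[_ /negbTE].
- by move=> x; rewrite inE => /andP[_ /negbTE].
- by move=> x; rewrite !inE.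
- by move=> x; rewrite !inE.
Qed.

End Tensor.

(* For [h : cod A = dom B], [comp h] is the composite of A followed by B. *)
Section Composition.
Context (A B : diagram D) (hAB : cod A = dom B).
Let pA := graph_planar A.
Let pB := graph_planar B.

Lemma comp_card : #|outG A| = #|inG B|.
Proof.
rewrite -(size_osort (outG A)) -(size_osort (inG B)).
have := congr1 size hAB; by rewrite !size_map.
Qed.

Let C := PlanarGraph (comp_planar pA pB comp_card).

Definition comp_ob (u : C) : Ob D :=
  match val u with inl a => dob a | inr b => dob b end.
Definition comp_mor (u : C) : option (Mor D) :=
  match val u with inl a => dmor a | inr b => dmor b end.

Lemma graft_ob (o : A) (i : B) : graft o i -> dob o = dob i.
Proof.
move=> g; have [oO iI e] := graftP g.
have o1 : index o (osort (outG A)) < size (osort (outG A)) by rewrite index_mem mem_osort.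
have i1 : index i (osort (inG B)) < size (osort (inG B)) by rewrite index_mem mem_osort.
transitivity (nth (dob o) (cod A) (index o (osort (outG A)))).
  by rewrite (nth_map o) // nth_index ?mem_osort.
rewrite hAB (index_rank pA (@posO A) oO) e -(index_rank pB (@posI B) iI).
by rewrite (nth_map i) // nth_index ?mem_osort.
Qed.

Lemma comp_ob_opp u : comp_ob (opp u) = comp_ob u.
Proof.
rewrite /comp_ob (val_opp pA pB); have := valP u; case: (val u) => [a|b] h.
- case: (opplP pB h) => [i va pa g vi|i na g ni|na _].
  + by rewrite dob_opp -(graft_ob g) dob_opp.
  + by rewrite (graft_ob g).
  + exact: dob_opp.
- case: (opprP pA h) => [i va pa g vi|i na g ni|na _].
  + by rewrite dob_opp (graft_ob g) dob_opp.
  + by rewrite (graft_ob g).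
  + exact: dob_opp.
Qed.

Lemma virt_mor (E : diagram D) (h : E) : virt h -> dmor h = None.
Proof. by move=> v; have := dmor_real h; rewrite v; case: (dmor h). Qed.

Lemma comp_mor_vtx (u v : C) : vtx u v -> comp_mor u = comp_mor v.
Proof.
rewrite -[vtx u v]/(comp_vtx (val u) (val v)) /comp_mor.
case: (val u) (val v) => a [] b /=; try exact: dmor_vtx.
  by case/and3P => va vb _; rewrite !virt_mor.
by case/and3P => va vb _; rewrite !virt_mor.
Qed.

Lemma comp_mor_real (u : C) : comp_mor u = ~~ virt u :> bool.
Proof.
rewrite (virtC pA pB) /comp_mor.
by case: (val u) => a; rewrite dmor_real.
Qed.

Lemma comp_inj_l (a : A) (u : C) (s : bool) : val u = inl a -> ~~ virt a ->
  [seq dob x | x <- osort [set x | vtx a x & pos x == s]] =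
  [seq comp_ob x | x <- osort [set x | vtx u x & pos x == s]].
Proof.
move=> eu na; pose g (v : C) : A := match val v with inl x => x | inr _ => a end.
have hin (v : C) : vtx u v -> exists2 x, val v = inl x & vtx a x.
  rewrite -[vtx u v]/(comp_vtx (val u) (val v)) eu.
  by case: (val v) => x /=; [exists x | rewrite (negbTE na)].
rewrite (@osort_map C A g [set x | vtx u x & pos x == s] _ s) //.
- rewrite -map_comp; apply/eq_in_map => v; rewrite mem_osort inE => /andP[v1 _].
  by have [x ev _] := hin v v1; rewrite /= /comp_ob /g ev.
- exact: (graph_planar C).
- by move=> v; rewrite inE => /andP[_ /eqP].
- by move=> v; rewrite inE => /andP[_ /eqP].
- move=> v w; rewrite !inE => /andP[v1 _] /andP[w1 _].
  have [x ev _] := hin v v1; have [y ew _] := hin w w1.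
  by rewrite -[prec v w]/(comp_prec (val v) (val w)) /g ev ew.
- apply/setP => x; rewrite inE; apply/imsetP/andP => [[v]|[ax sx]].
    rewrite inE => /andP[v1 sv] ->; have [y ev ay] := hin v v1.
    rewrite /g ev ay; split=> //; move: sv.
    by rewrite -[pos v]/(comp_pos (val v)) ev.
  have nx : ~~ virt x by apply: contra na => h; apply: (virt_vtx pA h); rewrite vtx_sym.
  exists (Sub _ (@real_keepl A B x nx)) => //.
  by rewrite inE -[vtx _ _]/(comp_vtx (val u) (inl x)) eu /= ax.
Qed.

Lemma comp_inj_r (a : B) (u : C) (s : bool) : val u = inr a -> ~~ virt a ->
  [seq dob x | x <- osort [set x | vtx a x & pos x == s]] =
  [seq comp_ob x | x <- osort [set x | vtx u x & pos x == s]].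
Proof.
move=> eu na; pose g (v : C) : B := match val v with inr x => x | inl _ => a end.
have hin (v : C) : vtx u v -> exists2 x, val v = inr x & vtx a x.
  rewrite -[vtx u v]/(comp_vtx (val u) (val v)) eu.
  by case: (val v) => x /=; [rewrite (negbTE na) andbF | exists x].
rewrite (@osort_map C B g [set x | vtx u x & pos x == s] _ s) //.
- rewrite -map_comp; apply/eq_in_map => v; rewrite mem_osort inE => /andP[v1 _].
  by have [x ev _] := hin v v1; rewrite /= /comp_ob /g ev.
- exact: (graph_planar C).
- by move=> v; rewrite inE => /andP[_ /eqP].
- by move=> v; rewrite inE => /andP[_ /eqP].
- move=> v w; rewrite !inE => /andP[v1 _] /andP[w1 _].
  have [x ev _] := hin v v1; have [y ew _] := hin w w1.
  by rewrite -[prec v w]/(comp_prec (val v) (val w)) /g ev ew.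
- apply/setP => x; rewrite inE; apply/imsetP/andP => [[v]|[ax sx]].
    rewrite inE => /andP[v1 sv] ->; have [y ev ay] := hin v v1.
    rewrite /g ev ay; split=> //; move: sv.
    by rewrite -[pos v]/(comp_pos (val v)) ev.
  have nx : ~~ virt x by apply: contra na => h; apply: (virt_vtx pB h); rewrite vtx_sym.
  exists (Sub _ (@real_keepr A B x nx)) => //.
  by rewrite inE -[vtx _ _]/(comp_vtx (val u) (inr x)) eu /= ax.
Qed.

Lemma inVE (G : pregraph) (h : G) : inV h = [set x | vtx h x & pos x == true].
Proof. by apply/setP => x; rewrite !inE eqb_id. Qed.

Lemma outVE (G : pregraph) (h : G) : outV h = [set x | vtx h x & pos x == false].
Proof. by apply/setP => x; rewrite !inE eqbF_neg. Qed.

Lemma some_real (E : diagram D) (h : E) f : dmor h = Some f -> ~~ virt h.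
Proof. by move=> e; rewrite -dmor_real e. Qed.

Lemma comp_mor_src (u : C) f : comp_mor u = Some f ->
  src f = [seq comp_ob x | x <- osort (inV u)].
Proof.
rewrite /comp_mor inVE; case eu: (val u) => [a|a] e; rewrite (dmor_src e) inVE.
- exact: (comp_inj_l _ eu (some_real e)).
- exact: (comp_inj_r _ eu (some_real e)).
Qed.

Lemma comp_mor_tgt (u : C) f : comp_mor u = Some f ->
  tgt f = [seq comp_ob x | x <- osort (outV u)].
Proof.
rewrite /comp_mor outVE; case eu: (val u) => [a|a] e; rewrite (dmor_tgt e) outVE.
- exact: (comp_inj_l _ eu (some_real e)).
- exact: (comp_inj_r _ eu (some_real e)).
Qed.

Definition comp : diagram D :=
  @Diagram D C comp_ob comp_mor comp_ob_opp comp_mor_vtx comp_mor_real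
    comp_mor_src comp_mor_tgt.

Lemma comp_ceq_ob (x y : A + B) : ceq x y ->
  match x with inl a => dob a | inr b => dob b end =
  match y with inl a => dob a | inr b => dob b end :> Ob D.
Proof.
have se (E : diagram D) (a b : E) : same_edge a b -> dob a = dob b.
  by case/orP => /eqP -> //; rewrite dob_opp.
case: x y => a [] b /=; try exact: se.
- by case/mergedP => o [i [g s t]]; rewrite -(se _ _ _ s) -(se _ _ _ t) (graft_ob g).
- by case/mergedP => o [i [g s t]]; rewrite -(se _ _ _ s) -(se _ _ _ t) (graft_ob g).
Qed.

Lemma val_oppC (u : C) : val (opp u) = comp_opp (val u).
Proof. exact: (val_opp pA pB). Qed.

Lemma legC_real (u : C) : leg u -> ~~ comp_virt (val u) -> comp_opp (val u) = val u.
Proof.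
by rewrite /leg (virtC pA pB) => /orP[/eqP e|->] //; rewrite -val_oppC e.
Qed.

Lemma legC_intro (u : C) :
  comp_virt (val u) \/ comp_opp (val u) = val u -> leg u.
Proof.
rewrite /leg (virtC pA pB) => -[->|e]; first by rewrite orbT.
by apply/orP; left; apply/eqP/val_inj; rewrite val_oppC.
Qed.

Lemma dom_comp : dom comp = dom A.
Proof.
case: (pickP (fun a : A => true)) => [a0 _|nA]; last first.
  have nC (u : C) : False.
    case: (val u) => [a|b]; first by have := nA a.
    have [i iI _] := in_reach pB b.
    by have [o _] := graft_exr pA pB comp_card iI; have := nA o.
  rewrite /dom; case: (osort (inG A)) => [|a l]; last by have := nA a.
  by case: (osort (inG comp)) => [|u l] //; case: (nC u).
pose g (u : C) : A := match val u with
  | inl a => a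
  | inr b => if [pick o | graft o b] is Some o then opp o else a0 end.
have hg (u : C) : u \in inG C -> g u \in inG A /\ ceq (val u) (inl (g u)).
  rewrite inE => /andP[l]; rewrite -[pos u]/(comp_pos (val u)) /g.
  have kx := valP u; have lr := legC_real l.
  have lv : comp_virt (val u) \/ ~~ comp_virt (val u) by case: comp_virt; [left|right].
  case eu: (val u) kx lr lv => [a|b] kx lr lv /= pu.
    split; last exact: se_refl.
    rewrite inE pu andbT /leg; case: lv => [/= ->|nv]; first by rewrite orbT.
    have := lr nv; case: (opplP pB kx) => // _ _ [->]; by rewrite eqxx.
  case: lv => [vb|nv]; first by move: kx; rewrite /= in vb pu; rewrite /= vb pu.
  have e := lr nv; move: e; case: (opprP pA kx) => // _ hv [e].
  have bI : b \in inG B by rewrite inE /leg e eqxx.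
  have [o gr] := graft_exr pA pB comp_card bI.
  case: pickP => [o' gr'|n]; last by have := n o; rewrite gr.
  have vo := hv _ gr'; have [oO _ _] := graftP gr'; move: (oO).
  rewrite !inE (leg_opp pA) (graft_neg pA gr' vo) => /andP[-> _]; split=> //.
  apply/mergedP; exists o', b; split=> //; [exact: se_opp|exact: se_refl].
rewrite /dom (@osort_map C A g (inG C) (inG A) true).
- rewrite -map_comp; apply/eq_in_map => u; rewrite mem_osort => /hg[_ /comp_ceq_ob].
  by [].
- exact: (graph_planar C).
- exact: pA.
- by move=> u; rewrite inE => /andP[].
- by move=> u; rewrite inE => /andP[].
- move=> u v /hg[_ eu] /hg[_ ev].
  rewrite -[prec (g u) _]/(comp_prec (inl (g u) : A + B) (inl (g v))).
  have [<- _] := cprec_ceq pA pB (inl (g v)) eu.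
  by have [_ <-] := cprec_ceq pA pB (val u) ev.
- apply/setP => a; apply/imsetP/idP => [[u /hg[h _] ->] //|aI].
  move: (aI); rewrite inE => /andP[la pa].
  case: (boolP (virt a)) => va; last first.
    have k := @real_keepl A B a va.
    exists (Sub _ k) => //; rewrite inE; apply/andP; split; last exact: pa.
    apply: legC_intro; right; rewrite SubK; case: (opplP pB k) => [i va'|i _ gr _|_ _].
    + by rewrite va' in va.
    + by have [oO _ _] := graftP gr; move: oO; rewrite inE pa andbF.
    + by move: la; rewrite /leg (negbTE va) orbF => /eqP ->.
  have oO := leg_virt_out pA va pa.
  have [i gr] := graft_exl pA pB comp_card oO.
  case: (boolP (virt i)) => vi.
    have k := keepl va pa gr vi.
    exists (Sub _ k) => //; rewrite inE; apply/andP; split; last exact: pa.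
    by apply: legC_intro; left; rewrite SubK.
  have k := @real_keepr A B i vi; have [_ iI _] := graftP gr.
  exists (Sub _ k); last first.
    rewrite /g SubK; case: pickP => [o' gr'|n]; last by have := n (opp a); rewrite gr.
    by rewrite (graft_injl pA gr' gr) (oppK pA).
  rewrite inE; apply/andP; split; last by rewrite -[pos _]/(pos i) (posI iI).
  apply: legC_intro; right; rewrite SubK; case: (opprP pA k) => [o vi'|o _ gr' vo|_ _].
  + by rewrite vi' in vi.
  + by move: vo; rewrite (graft_injl pA gr' gr) (virt_opp pA) va.
  + by rewrite (real_leg2 gr vi).
Qed.

Lemma cod_comp : cod comp = cod B.
Proof.
case: (pickP (fun b : B => true)) => [b0 _|nB]; last first.
  have nC (u : C) : False.
    case: (val u) => [a|b]; last by have := nB b.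
    have [o oO _] := out_reach pA a.
    by have [i _] := graft_exl pA pB comp_card oO; have := nB i.
  rewrite /cod; case: (osort (outG B)) => [|a l]; last by have := nB a.
  by case: (osort (outG comp)) => [|u l] //; case: (nC u).
pose g (u : C) : B := match val u with
  | inr b => b
  | inl a => if [pick i | graft a i] is Some i then opp i else b0 end.
have hg (u : C) : u \in outG C -> g u \in outG B /\ ceq (val u) (inr (g u)).
  rewrite inE => /andP[l]; rewrite -[pos u]/(comp_pos (val u)) /g.
  have kx := valP u; have lr := legC_real l.
  have lv : comp_virt (val u) \/ ~~ comp_virt (val u) by case: comp_virt; [left|right].
  case eu: (val u) kx lr lv => [a|b] kx lr lv /= pu; last first.
    split; last exact: se_refl.
    rewrite inE pu andbT /leg; case: lv => [/= ->|nv]; first by rewrite orbT.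
    have := lr nv; case: (opprP pA kx) => // _ _ [->]; by rewrite eqxx.
  case: lv => [vb|nv].
    by move: kx; rewrite /= in vb pu; rewrite /= vb (negbTE pu).
  have e := lr nv; move: e; case: (opplP pB kx) => // _ hv [e].
  have aO : a \in outG A by rewrite inE /leg e eqxx.
  have [i gr] := graft_exl pA pB comp_card aO.
  case: pickP => [i' gr'|n]; last by have := n i; rewrite gr.
  have vi := hv _ gr'; have [_ iI _] := graftP gr'; move: (iI).
  rewrite !inE (leg_opp pB) (graft_pos pB gr' vi) => /andP[-> _]; split=> //.
  apply/mergedP; exists a, i'; split=> //; [exact: se_refl|exact: se_opp].
rewrite /cod (@osort_map C B g (outG C) (outG B) false).
- rewrite -map_comp; apply/eq_in_map => u; rewrite mem_osort => /hg[_ /comp_ceq_ob].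
  by [].
- exact: (graph_planar C).
- exact: pB.
- by move=> u; rewrite inE => /andP[_ /negbTE].
- by move=> u; rewrite inE => /andP[_ /negbTE].
- move=> u v /hg[_ eu] /hg[_ ev].
  rewrite -[prec (g u) _]/(comp_prec (inr (g u) : A + B) (inr (g v))).
  have [<- _] := cprec_ceq pA pB (inr (g v)) eu.
  by have [_ <-] := cprec_ceq pA pB (val u) ev.
- apply/setP => b; apply/imsetP/idP => [[u /hg[h _] ->] //|bO].
  move: (bO); rewrite inE => /andP[lb pb].
  case: (boolP (virt b)) => vb; last first.
    have k := @real_keepr A B b vb.
    exists (Sub _ k) => //; rewrite inE; apply/andP; split; last exact: pb.
    apply: legC_intro; right; rewrite SubK; case: (opprP pA k) => [o vb'|o _ gr _|_ _].
    + by rewrite vb' in vb.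
    + by have [_ iI _] := graftP gr; move: iI; rewrite inE (negbTE pb) andbF.
    + by move: lb; rewrite /leg (negbTE vb) orbF => /eqP ->.
  have iI := virt_negI pB vb pb.
  have [o gr] := graft_exr pA pB comp_card iI.
  case: (boolP (virt o)) => vo.
    have k := keepr vb pb gr vo.
    exists (Sub _ k) => //; rewrite inE; apply/andP; split; last exact: pb.
    by apply: legC_intro; left; rewrite SubK.
  have k := @real_keepl A B o vo; have [oO _ _] := graftP gr.
  exists (Sub _ k); last first.
    rewrite /g SubK; case: pickP => [i' gr'|n]; last by have := n (opp b); rewrite gr.
    by rewrite (graft_injr pB gr' gr) (oppK pB).
  rewrite inE; apply/andP; split; last by rewrite -[pos _]/(pos o) (posO oO).
  apply: legC_intro; right; rewrite SubK; case: (opplP pB k) => [i vo'|i _ gr' vi|_ _].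
  + by rewrite vo' in vo.
  + by move: vi; rewrite (graft_injr pB gr' gr) (virt_opp pB) vb.
  + by rewrite (real_leg1 gr vo).
Qed.

End Composition.
End Diagrams.

Section Iso.
Context {D : tensor_scheme}.
Implicit Types A B C : diagram D.

Lemma diso_refl A : diso A A.
Proof. by exists id; do !split=> //; exists id. Qed.

Lemma diso_trans A B C : diso A B -> diso B C -> diso A C.
Proof.
move=> [f [[f1 f2 f3 f4 f5] [f6 f7]]] [g [[g1 g2 g3 g4 g5] [g6 g7]]].
exists (g \o f); do !split.
- exact: bij_comp.
- by move=> x y /=; rewrite g2 f2.
- by move=> x /=; rewrite f3 g3.
- by move=> x /=; rewrite g4 f4.
- by move=> x y /=; rewrite g5 f5.
- by move=> x /=; rewrite g6 f6.
- by move=> x /=; rewrite g7 f7.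
Qed.

Lemma diso_osort A B (s : bool) : diso A B ->
  [seq dob x | x <- osort [set x : A | leg x & pos x == s]] =
  [seq dob x | x <- osort [set x : B | leg x & pos x == s]].
Proof.
move=> [f [[f1 f2 f3 f4 f5] [f6 f7]]].
have fi : injective f by apply: bij_inj.
have fl (x : A) : leg (f x) = leg x.
  by rewrite /leg /virt -f3 !(inj_eq fi) f2.
rewrite (@osort_map A B f [set x : A | leg x & pos x == s] [set x : B | leg x & pos x == s] s).
- by rewrite -map_comp; apply: eq_map => x; rewrite /= f6.
- exact: graph_planar.
- exact: graph_planar.
- by move=> x; rewrite inE => /andP[_ /eqP].
- by move=> x; rewrite inE => /andP[_ /eqP].
- by move=> x y _ _; rewrite f5.
- apply/setP => y; rewrite inE; apply/imsetP/idP => [[x]|].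
    by rewrite inE => h ->; rewrite fl f4.
  by have [g gK Kg] := f1; rewrite -(Kg y) fl f4 => h; exists (g y); rewrite ?inE.
Qed.

Lemma inGE (G : pregraph) : inG G = [set x | leg x & pos x == true].
Proof. by apply/setP => x; rewrite !inE eqb_id. Qed.

Lemma outGE (G : pregraph) : outG G = [set x | leg x & pos x == false].
Proof. by apply/setP => x; rewrite !inE eqbF_neg. Qed.

Lemma diso_dom A B : diso A B -> dom A = dom B.
Proof. by rewrite /dom !inGE; apply: diso_osort. Qed.

Lemma diso_cod A B : diso A B -> cod A = cod B.
Proof. by rewrite /cod !outGE; apply: diso_osort. Qed.

Definition id_diagram (w : seq (Ob D)) : diagram D :=
  foldr (fun x A => tensor (unit_diagram x) A) empty_diagram w.

Lemma dom_id w : dom (id_diagram w) = w.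
Proof. by elim: w => [|x w IH] /=; rewrite ?dom_empty // dom_tensor dom_unit IH. Qed.

Lemma cod_id w : cod (id_diagram w) = w.
Proof. by elim: w => [|x w IH] /=; rewrite ?cod_empty // cod_tensor cod_unit IH. Qed.

End Iso.

(* The morphisms of T(D). Diagrams are taken up to isomorphism: the third
   component is an isomorphism class. *)
Record bracketed (D : tensor_scheme) := Bracketed {
  bsrc : seq (seq (Ob D));
  btgt : seq (seq (Ob D));
  bclass : diagram D -> Prop;
  bsrc_gt0 : 0 < size bsrc;
  btgt_gt0 : 0 < size btgt;
  bclassP : exists G, [/\ dom G = flatten bsrc, cod G = flatten btgt &
    forall G', bclass G' <-> diso G G'] }.

Definition T (D : tensor_scheme) : tensor_scheme :=
  @TensorScheme (seq (Ob D)) (bracketed D) (@bsrc D) (@btgt D)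
    (@bsrc_gt0 D) (@btgt_gt0 D).

Lemma bracket_subproof (D : tensor_scheme) (ws us : seq (seq (Ob D)))
    (G : diagram D) (hd : dom G = flatten ws) (hc : cod G = flatten us) :
  exists G0, [/\ dom G0 = flatten ws, cod G0 = flatten us &
    forall G', diso G G' <-> diso G0 G'].
Proof. by exists G. Qed.

(* the bracketed diagram (ws; us; G) *)
Definition bracket (D : tensor_scheme) (ws us : seq (seq (Ob D)))
    (G : diagram D) (hw : 0 < size ws) (hu : 0 < size us)
    (hd : dom G = flatten ws) (hc : cod G = flatten us) : Mor (T D) :=
  @Bracketed D ws us (diso G) hw hu (bracket_subproof hd hc).

Section Relabel.
Context {D E : tensor_scheme} (phi : scheme_mor D E).

Section RelabelDiagram.
Context (A : diagram D).

Lemma relabel_opp (h : A) : mob phi (dob (opp h)) = mob phi (dob h).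
Proof. by rewrite dob_opp. Qed.

Lemma relabel_vtx (h h' : A) : vtx h h' ->
  omap (mmor phi) (dmor h) = omap (mmor phi) (dmor h').
Proof. by move=> /dmor_vtx ->. Qed.

Lemma relabel_real (h : A) : omap (mmor phi) (dmor h) = ~~ virt h :> bool.
Proof. by rewrite -dmor_real; case: (dmor h). Qed.

Lemma relabel_src (h : A) f : omap (mmor phi) (dmor h) = Some f ->
  src f = [seq mob phi (dob x) | x <- osort (inV h)].
Proof.
case e: (dmor h) => [g|] //= -[<-].
by rewrite src_mmor (dmor_src e) -map_comp.
Qed.

Lemma relabel_tgt (h : A) f : omap (mmor phi) (dmor h) = Some f ->
  tgt f = [seq mob phi (dob x) | x <- osort (outV h)].
Proof.
case e: (dmor h) => [g|] //= -[<-].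
by rewrite tgt_mmor (dmor_tgt e) -map_comp.
Qed.

Definition relabel : diagram E :=
  @Diagram E (dgraph A) (fun h => mob phi (dob h))
    (fun h => omap (mmor phi) (dmor h))
    relabel_opp relabel_vtx relabel_real relabel_src relabel_tgt.

Lemma dom_relabel : dom relabel = map (mob phi) (dom A).
Proof. by rewrite /dom -map_comp. Qed.

Lemma cod_relabel : cod relabel = map (mob phi) (cod A).
Proof. by rewrite /cod -map_comp. Qed.

End RelabelDiagram.

Lemma relabel_iso (A B : diagram D) : diso A B -> diso (relabel A) (relabel B).
Proof.
move=> [f [hf [f6 f7]]]; exists f; split; first exact: hf.
by split=> x; rewrite /= ?f6 ?f7.
Qed.

Section TMor.
Context (b : Mor (T D)).

Definition T_class (G' : diagram E) : Prop :=
  exists2 G, bclass b G & diso (relabel G) G'.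

Lemma T_src_gt0 : 0 < size (map (map (mob phi)) (bsrc b)).
Proof. by rewrite size_map bsrc_gt0. Qed.

Lemma T_tgt_gt0 : 0 < size (map (map (mob phi)) (btgt b)).
Proof. by rewrite size_map btgt_gt0. Qed.

Lemma T_classP : exists G,
  [/\ dom G = flatten (map (map (mob phi)) (bsrc b)),
      cod G = flatten (map (map (mob phi)) (btgt b)) &
      forall G', T_class G' <-> diso G G'].
Proof.
have [G [hd hc hG]] := bclassP b; exists (relabel G); split.
- by rewrite dom_relabel hd map_flatten.
- by rewrite cod_relabel hc map_flatten.
- move=> G'; split=> [[G1 /hG h]|h]; last by exists G => //; apply/hG/diso_refl.
  exact/diso_trans/relabel_iso.
Qed.

Definition T_mor : Mor (T E) := Bracketed T_src_gt0 T_tgt_gt0 T_classP.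

End TMor.

Definition Tmap : scheme_mor (T D) (T E) :=
  @SchemeMor (T D) (T E) (map (mob phi)) T_mor
    (fun _ => erefl) (fun _ => erefl).

End Relabel.

(* the word (x_1)...(x_n) of one-letter words *)
Definition letters (X : Type) (w : seq X) : seq (seq X) := [seq [:: x] | x <- w].

Lemma flatten_letters (X : Type) (w : seq X) : flatten (letters w) = w.
Proof. by elim: w => //= x w ->. Qed.

Section Eta.
Context {D : tensor_scheme}.

Lemma letters_src_gt0 (f : Mor D) : 0 < size (letters (src f)).
Proof. by rewrite size_map src_gt0. Qed.

Lemma letters_tgt_gt0 (f : Mor D) : 0 < size (letters (tgt f)).
Proof. by rewrite size_map tgt_gt0. Qed.

Definition eta_mor (f : Mor D) : Mor (T D) :=
  bracket (letters_src_gt0 f) (letters_tgt_gt0 f)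
    (etrans (dom_prime f) (esym (flatten_letters _)))
    (etrans (cod_prime f) (esym (flatten_letters _))).

Definition eta : scheme_mor D (T D) :=
  @SchemeMor D (T D) (fun x => [:: x]) eta_mor (fun _ => erefl) (fun _ => erefl).

End Eta.

(* [value A G]: the diagram G in D represents the value in F(D) of the diagram
   A in T(D). This is the graph of the strict monoidal functor F(T(D)) -> F(D)
   given by concatenation on objects and sending the prime diagram decorated
   by a bracketed diagram to the underlying diagram; a letter of a word in
   Ob(T(D)) is itself a word, whence the clause for unitary diagrams. *)
Inductive value (D : tensor_scheme) : diagram (T D) -> diagram D -> Prop :=
| value_prime (b : Mor (T D)) (G : diagram D) :
    bclass b G -> value (prime_diagram b) G
| value_unit (w : Ob (T D)) : value (unit_diagram w) (id_diagram w)
| value_empty : value empty_diagram empty_diagram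
| value_tensor (A B : diagram (T D)) (G K : diagram D) :
    value A G -> value B K -> value (tensor A B) (tensor G K)
| value_comp (A B : diagram (T D)) (G K : diagram D)
    (hAB : cod A = dom B) (hGK : cod G = dom K) :
    value A G -> value B K -> value (comp hAB) (comp hGK)
| value_iso (A B : diagram (T D)) (G K : diagram D) :
    diso A B -> diso G K -> value A G -> value B K.

Lemma value_dom_cod (D : tensor_scheme) (A : diagram (T D)) (G : diagram D) :
  value A G -> dom G = flatten (dom A) /\ cod G = flatten (cod A).
Proof.
elim=> [b K hK|w||A1 A2 G1 G2 _ [d1 c1] _ [d2 c2]|A1 A2 G1 G2 h h' _ [d1 c1] _ [d2 c2]
       |A1 A2 G1 G2 hA hG _ [d1 c1]].
- have [K0 [hd hc hK0]] := bclassP b; have i := iffLR (hK0 K) hK.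
  by rewrite dom_prime cod_prime -(diso_dom i) -(diso_cod i) hd hc.
- by rewrite dom_unit cod_unit dom_id cod_id /= cats0.
- by rewrite !dom_empty !cod_empty.
- by rewrite !dom_tensor !cod_tensor !flatten_cat d1 d2 c1 c2.
- by rewrite !dom_comp !cod_comp.
- by rewrite -(diso_dom hA) -(diso_cod hA) -(diso_dom hG) -(diso_cod hG).
Qed.

(* The multiplication of the monad: [mu_ob] is its action on objects and
   [is_mu] the graph of its action on morphisms. *)
Definition mu_ob (D : tensor_scheme) (W : Ob (T (T D))) : Ob (T D) := flatten W.

Definition is_mu (D : tensor_scheme) (b : Mor (T (T D))) (c : Mor (T D)) : Prop :=
  [/\ src c = map (@mu_ob D) (src b), tgt c = map (@mu_ob D) (tgt b) &
      exists A G, [/\ bclass b A, bclass c G & value A G]].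

Record tensor_manifold := TensorManifold {
  scheme :> tensor_scheme;
  eps : scheme_mor (T scheme) scheme;
  eps_mu_ob : forall W : Ob (T (T scheme)),
    mob eps (mob (Tmap eps) W) = mob eps (mu_ob W);
  eps_mu_mor : forall (b : Mor (T (T scheme))) (c : Mor (T scheme)),
    is_mu b c -> mmor eps (mmor (Tmap eps) b) = mmor eps c;
  eps_eta_ob : forall x : Ob scheme, mob eps (mob eta x) = x;
  eps_eta_mor : forall f : Mor scheme, mmor eps (mmor eta f) = f }.

Section Operations.
Context {M : tensor_manifold}.
Implicit Types f g : Mor M.

Lemma eps_letters (w : seq (Ob M)) : map (mob (eps M)) (letters w) = w.
Proof.
rewrite /letters -map_comp -[RHS]map_id; apply: eq_map => x.
exact: (eps_eta_ob x).
Qed.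

Section Tensor.
Context (f g : Mor M).

Lemma eps_tensor_src_gt0 : 0 < size (letters (src f ++ src g)).
Proof. by rewrite size_map size_cat addn_gt0 src_gt0. Qed.

Lemma eps_tensor_tgt_gt0 : 0 < size (letters (tgt f ++ tgt g)).
Proof. by rewrite size_map size_cat addn_gt0 tgt_gt0. Qed.

Lemma eps_tensor_dom : dom (tensor (prime_diagram f) (prime_diagram g)) =
  flatten (letters (src f ++ src g)).
Proof. by rewrite dom_tensor !dom_prime flatten_letters. Qed.

Lemma eps_tensor_cod : cod (tensor (prime_diagram f) (prime_diagram g)) =
  flatten (letters (tgt f ++ tgt g)).
Proof. by rewrite cod_tensor !cod_prime flatten_letters. Qed.

Definition eps_tensor : Mor M :=
  mmor (eps M) (bracket eps_tensor_src_gt0 eps_tensor_tgt_gt0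
                        eps_tensor_dom eps_tensor_cod).

Lemma src_eps_tensor : src eps_tensor = src f ++ src g.
Proof. by rewrite src_mmor eps_letters. Qed.

Lemma tgt_eps_tensor : tgt eps_tensor = tgt f ++ tgt g.
Proof. by rewrite tgt_mmor eps_letters. Qed.

End Tensor.

Section Composition.
Context (g f : Mor M) (h : tgt f = src g).

Lemma eps_comp_prime : cod (prime_diagram f) = dom (prime_diagram g).
Proof. by rewrite cod_prime dom_prime. Qed.

Lemma eps_comp_dom : dom (comp eps_comp_prime) = flatten (letters (src f)).
Proof. by rewrite dom_comp dom_prime flatten_letters. Qed.

Lemma eps_comp_cod : cod (comp eps_comp_prime) = flatten (letters (tgt g)).
Proof. by rewrite cod_comp cod_prime flatten_letters. Qed.

Definition eps_comp : Mor M :=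
  mmor (eps M) (bracket (letters_src_gt0 f) (letters_tgt_gt0 g)
                        eps_comp_dom eps_comp_cod).

Lemma src_eps_comp : src eps_comp = src f.
Proof. by rewrite src_mmor eps_letters. Qed.

Lemma tgt_eps_comp : tgt eps_comp = tgt g.
Proof. by rewrite tgt_mmor eps_letters. Qed.

End Composition.

Lemma eps_tensor_match (f1 g1 f2 g2 : Mor M) :
  tgt f1 = src g1 -> tgt f2 = src g2 ->
  tgt (eps_tensor f1 f2) = src (eps_tensor g1 g2).
Proof. by move=> h1 h2; rewrite tgt_eps_tensor src_eps_tensor h1 h2. Qed.

End Operations.

Arguments eps_comp {M} g f h.

(* Main.v *)
From mathcomp Require Import all_boot.
From mathcomp.classical Require Import boolp.
Require Import Defs.

(** The law holds already for diagrams: composing the disjoint unions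
    A1 + A2 and B1 + B2 produces the same planar graph as the disjoint union of
    the composites of A1 with B1 and of A2 with B2 (tensor_comp_interchange).
    Indeed A1 has as many outputs as B1 has inputs, so the k-th output of
    A1 + A2 is grafted to the k-th input of B1 + B2 within one of the two
    pairs, never across; and in the composite order an edge from the first pair
    comes before any edge from the second, because every edge of B2 is reached
    from an input of B2.

    The algebra axiom transports this to a tensor manifold M. Write K for the
    composite of the tensor products of the prime diagrams of the four
    morphisms. Each side of the law is obtained by evaluating with eps in two
    stages: it is the value under eps of a two-vertex diagram whose vertices
    are decorated by values under eps, i.e. of the relabelling along eps of a
    diagram in T(M). Associativity of eps (eps_value) lets one substitute first
    and evaluate once. Substitution gives K on the left and the tensor product
    of the composites on the right; these are isomorphic, so both sides are the
    value of the same bracketed diagram. *)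

Set Implicit Arguments.
Unset Strict Implicit.
Unset Printing Implicit Defensive.

(** * Finite sets under bijections and disjoint unions *)

Lemma exists_sum (S T : finType) (P : pred (S + T)) :
  [exists x, P x] = [exists a, P (inl a)] || [exists b, P (inr b)].
Proof.
apply/existsP/orP => [[[a|b] p]|[] /existsP[a p]].
- by left; apply/existsP; exists a.
- by right; apply/existsP; exists b.
- by exists (inl a).
- by exists (inr a).
Qed.

Lemma exists_bij (S T : finType) (f : S -> T) (P : pred T) :
  bijective f -> [exists y, P y] = [exists x, P (f x)].
Proof.
case=> g fK gK; apply/existsP/existsP => -[x p]; last by exists (f x).
by exists (g x); rewrite gK.
Qed.

Lemma card_bij_set (S T : finType) (f : S -> T) (X : {set S}) (Y : {set T}) :
  bijective f -> (forall x, (f x \in Y) = (x \in X)) -> #|Y| = #|X|.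
Proof.
move=> fB h; have -> : X = f @^-1: Y by apply/setP => x; rewrite inE h.
by rewrite on_card_preimset //; apply: onW_bij.
Qed.

Lemma card_sum_set (S T : finType) (Z : {set S + T}) :
  #|Z| = #|[set a | inl a \in Z]| + #|[set b | inr b \in Z]|.
Proof.
rewrite -!sum1_card big_sumType /=.
by congr addn; apply: eq_bigl => x; rewrite inE.
Qed.

Lemma surj_inj_bij (S : finType) (T : eqType) (f : S -> T) :
  injective f -> (forall y, exists x, f x = y) -> bijective f.
Proof.
move=> fI fS; have ex y : exists x, f x == y by have [x <-] := fS y; exists x.
have fK y : f (xchoose (ex y)) = y by apply/eqP/(xchooseP (ex y)).
by exists (fun y => xchoose (ex y)) => // x; apply: fI.
Qed.

(** * Isomorphisms of diagrams *)

Section GraphIso.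
Context {G G' : pregraph} (f : G -> G') (f_bij : bijective f).
Context (f_vtx : forall x y, vtx (f x) (f y) = vtx x y).
Context (f_opp : forall x, f (opp x) = opp (f x)).
Context (f_pos : forall x, pos (f x) = pos x).
Context (f_prec : forall x y, prec (f x) (f y) = prec x y).

Lemma iso_same_edge x y : same_edge (f x) (f y) = same_edge x y.
Proof. by rewrite /same_edge -f_opp !(inj_eq (bij_inj f_bij)). Qed.

Lemma iso_virt x : virt (f x) = virt x.
Proof. by rewrite /virt -f_opp f_vtx (inj_eq (bij_inj f_bij)). Qed.

Lemma iso_leg x : leg (f x) = leg x.
Proof. by rewrite /leg iso_virt -f_opp (inj_eq (bij_inj f_bij)). Qed.

Lemma iso_in x : (f x \in inG G') = (x \in inG G).
Proof. by rewrite !inE iso_leg f_pos. Qed.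

Lemma iso_out x : (f x \in outG G') = (x \in outG G).
Proof. by rewrite !inE iso_leg f_pos. Qed.

Lemma iso_rank (A : {set G}) (A' : {set G'}) x :
  (forall y, (f y \in A') = (y \in A)) -> rank A' (f x) = rank A x.
Proof.
by move=> h; apply: card_bij_set f_bij _ => y; rewrite !inE h f_prec.
Qed.

Lemma iso_wrank (A : {set G}) (A' : {set G'}) x :
  (forall y, (f y \in A') = (y \in A)) -> wrank A' (f x) = wrank A x.
Proof.
by move=> h; apply: card_bij_set f_bij _ => y; rewrite !inE h f_prec.
Qed.

End GraphIso.

(** By totality, incomparable half-edges lie on a common edge; hence the order
    alone determines the partition into edges. *)
Lemma same_edge_prec (G : pregraph) (pG : planar G) (a b : G) :
  same_edge a b = ~~ prec a b && ~~ prec b a.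
Proof.
apply/idP/andP => [s|[n /negbTE n']].
  by split; apply: (se_nprec pG); rewrite // se_sym.
by have /orP[//|] := nprec pG n; rewrite n'.
Qed.

(** The order on half-edges determines the edges, and an edge determines the
    involution on its half-edges: a bijection preserving the order therefore
    commutes with the involution. This spares the case analysis of the grafted
    involution in the construction of isomorphisms of composites. *)
Lemma prec_iso_opp (G G' : pregraph) (f : G -> G') :
  planar G -> planar G' -> bijective f ->
  (forall x y, prec (f x) (f y) = prec x y) ->
  forall x, f (opp x) = opp (f x).
Proof.
move=> pG pG' fB hp x.
have se y z : same_edge (f y) (f z) = same_edge y z.
  by rewrite !same_edge_prec // !hp.
have := se_opp x; rewrite -se => /orP[/eqP/(bij_inj fB) e|/eqP //].
(* Here opp x = x, so the edge of x is the single half-edge x, and so must be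
   that of f x. *)
rewrite e; case: fB => g _ gK.
have := se_opp (f x); rewrite -(gK (opp (f x))) se.
by case/orP => /eqP ->; rewrite ?e.
Qed.

Section DiagramIso.
Context {D : tensor_scheme}.
Implicit Types A B C : diagram D.

Lemma diso_intro A B (f : A -> B) :
  injective f -> (forall y, exists x, f x = y) ->
  (forall x y, vtx (f x) (f y) = vtx x y) ->
  (forall x, pos (f x) = pos x) ->
  (forall x y, prec (f x) (f y) = prec x y) ->
  (forall x, dob (f x) = dob x) -> (forall x, dmor (f x) = dmor x) ->
  diso A B.
Proof.
move=> fI fS hv hs hp ho hm; have fB := surj_inj_bij fI fS.
exists f; split; last by split.
by split=> //; apply: (prec_iso_opp (graph_planar A) (graph_planar B) fB).
Qed.

Lemma diso_sym A B : diso A B -> diso B A.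
Proof.
move=> [f [[[g fK gK] f2 f3 f4 f5] [f6 f7]]].
apply: (@diso_intro B A g).
- exact: can_inj gK.
- by move=> x; exists (f x).
- by move=> x y; rewrite -f2 !gK.
- by move=> x; rewrite -f4 gK.
- by move=> x y; rewrite -f5 !gK.
- by move=> x; rewrite -f6 gK.
- by move=> x; rewrite -f7 gK.
Qed.

Lemma diso_tensor A A' B B' :
  diso A A' -> diso B B' -> diso (tensor A B) (tensor A' B').
Proof.
move=> [f [[fB f2 f3 f4 f5] [f6 f7]]] [g [[gB g2 g3 g4 g5] [g6 g7]]].
pose F (x : tensor A B) : tensor A' B' :=
  match x with inl a => inl (f a) | inr b => inr (g b) end.
apply: (@diso_intro _ _ F).
- by case=> x [] y // [] => [/(bij_inj fB)|/(bij_inj gB)] ->.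
- have [f' _ fK] := fB; have [g' _ gK] := gB.
  by case=> y; [exists (inl (f' y)) => /=; rewrite fK | exists (inr (g' y)) => /=; rewrite gK].
- by case=> x [] y /=.
- by case=> x /=.
- by case=> x [] y /=.
- by case=> x /=.
- by case=> x /=.
Qed.

(** Grafting depends only on the ranks of legs, which isomorphisms preserve;
    hence the sum of two isomorphisms restricts to the half-edges that survive
    in the composites. *)
Lemma diso_comp A A' B B' (h : cod A = dom B) (h' : cod A' = dom B') :
  diso A A' -> diso B B' -> diso (comp h) (comp h').
Proof.
move=> [f [[fB f2 f3 f4 f5] [f6 f7]]] [g [[gB g2 g3 g4 g5] [g6 g7]]].
have fV x : virt (f x) = virt x by apply: iso_virt.
have gV x : virt (g x) = virt x by apply: iso_virt.
have fR x : rank (outG A') (f x) = rank (outG A) x.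
  by apply: iso_rank => // y; apply: iso_out.
have gR x : rank (inG B') (g x) = rank (inG B) x.
  by apply: iso_rank => // y; apply: iso_in.
have gW x : wrank (inG B') (g x) = wrank (inG B) x.
  by apply: iso_wrank => // y; apply: iso_in.
have gr o i : graft (f o) (g i) = graft o i.
  by rewrite /graft (iso_out fB) // (iso_in gB) // fR gR.
have mg a b : merged (f a) (g b) = merged a b.
  rewrite /merged (exists_bij _ fB); apply: eq_existsb => o.
  rewrite (exists_bij _ gB); apply: eq_existsb => i.
  by rewrite gr (iso_same_edge fB) // (iso_same_edge gB).
pose F (x : A + B) : A' + B' :=
  match x with inl a => inl (f a) | inr b => inr (g b) end.
have FI : injective F.
  by case=> x [] y // [] => [/(bij_inj fB)|/(bij_inj gB)] ->.
have hk x : comp_keep (F x) = comp_keep x.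
  case: x => x /=.
    rewrite fV f4 -f3; congr (_ ==> _ && _).
    by rewrite (exists_bij _ gB); apply: eq_existsb => i; rewrite gr gV.
  rewrite gV g4 -g3; congr (_ ==> _ && _).
  by rewrite (exists_bij _ fB); apply: eq_existsb => i; rewrite gr fV.
pose H (u : comp h) : comp h' := exist (fun x => comp_keep x) (F (val u)) (etrans (hk _) (valP u)).
apply: (@diso_intro _ _ H).
- by move=> u v /(congr1 val) /= /FI /val_inj.
- move=> [y ky]; have [x e] : exists x, F x = y.
    have [f' _ fK] := fB; have [g' _ gK] := gB.
    by case: (y) => z; [exists (inl (f' z)) => /=; rewrite fK | exists (inr (g' z)) => /=; rewrite gK].
  have kx : comp_keep x by rewrite -hk e.
  by exists (exist _ x kx); apply: val_inj.
- by case=> [[x|x] kx] [[y|y] ky] /=; rewrite ?f2 ?g2 ?fV ?gV ?mg.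
- by case=> [[x|x] kx] /=; rewrite ?f4 ?g4.
- by case=> [[x|x] kx] [[y|y] ky] /=; rewrite ?f5 ?g5 ?fR ?gW ?mg.
- by case=> [[x|x] kx] /=; rewrite /comp_ob /= ?f6 ?g6.
- by case=> [[x|x] kx] /=; rewrite /comp_mor /= ?f7 ?g7.
Qed.

End DiagramIso.

(** * The interchange law for diagrams *)

Section SumRank.
Context {G1 G2 : pregraph}.
Let S := sum_pregraph G1 G2.

Lemma sum_in_l (a : G1) : ((inl a : S) \in inG S) = (a \in inG G1).
Proof. by rewrite !inE. Qed.

Lemma sum_in_r (b : G2) : ((inr b : S) \in inG S) = (b \in inG G2).
Proof. by rewrite !inE. Qed.

Lemma sum_out_l (a : G1) : ((inl a : S) \in outG S) = (a \in outG G1).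
Proof. by rewrite !inE. Qed.

Lemma sum_out_r (b : G2) : ((inr b : S) \in outG S) = (b \in outG G2).
Proof. by rewrite !inE. Qed.

Section Rank.
Context (Z : {set S}) (X : {set G1}) (Y : {set G2}).
Context (eX : forall a, (inl a \in Z) = (a \in X)).
Context (eY : forall b, (inr b \in Z) = (b \in Y)).

Lemma sum_rank_l a : rank Z (inl a : S) = rank X a.
Proof.
rewrite /rank card_sum_set [X in _ + X]eq_card0 ?addn0 => [|b].
  by apply: eq_card => x; rewrite !inE eX.
by rewrite !inE andbF.
Qed.

Lemma sum_rank_r b : rank Z (inr b : S) = #|X| + rank Y b.
Proof.
rewrite /rank card_sum_set; congr addn; apply: eq_card => x.
  by rewrite !inE eX andbT.
by rewrite !inE eY.
Qed.

Lemma sum_wrank_l a : wrank Z (inl a : S) = wrank X a.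
Proof.
rewrite /wrank card_sum_set [X in _ + X]eq_card0 ?addn0 => [|b].
  by apply: eq_card => x; rewrite !inE eX.
by rewrite !inE andbF.
Qed.

Lemma sum_wrank_r b : wrank Z (inr b : S) = #|X| + wrank Y b.
Proof.
rewrite /wrank card_sum_set; congr addn; apply: eq_card => x.
  by rewrite !inE eX andbT.
by rewrite !inE eY.
Qed.

End Rank.
End SumRank.

(** Some input reaches b, and it weakly precedes b. This is what puts the edges
    of B2 after those of A1 in the composite of A1 + A2 with B1 + B2. *)
Lemma wrank_in_gt0 (G : pregraph) (pG : planar G) (b : G) : 0 < wrank (inG G) b.
Proof.
have [i iI r] := in_reach pG b; apply/card_gt0P; exists i; rewrite inE iI /=.
case/orP: (reach_le pG r) => [s|]; last exact: prec_asym.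
by apply: (se_nprec pG); rewrite se_sym.
Qed.

Lemma existsb_false (T : finType) (P : pred T) :
  (forall x, P x = false) -> [exists x, P x] = false.
Proof. by move=> h; apply/existsP => -[x]; rewrite h. Qed.

Section SumGraft.
Context {A1 A2 B1 B2 : pregraph}.
Context (pA1 : planar A1) (pB1 : planar B1).
Context (h1 : #|outG A1| = #|inG B1|).
Let A := sum_pregraph A1 A2.
Let B := sum_pregraph B1 B2.

Let rAl a : rank (outG A) (inl a) = rank (outG A1) a.
Proof. exact/sum_rank_l/sum_out_l. Qed.

Let rAr a : rank (outG A) (inr a) = #|outG A1| + rank (outG A2) a.
Proof. by apply: sum_rank_r; [exact: sum_out_l | exact: sum_out_r]. Qed.

Let rBl b : rank (inG B) (inl b) = rank (inG B1) b.
Proof. exact/sum_rank_l/sum_in_l. Qed.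

Let rBr b : rank (inG B) (inr b) = #|outG A1| + rank (inG B2) b.
Proof. by rewrite h1; apply: sum_rank_r; [exact: sum_in_l | exact: sum_in_r]. Qed.

(** The outputs of A1 occupy the first ranks and the inputs of B1 as many, so
    equality of ranks can only match A1 with B1 and A2 with B2. *)
Lemma sum_graft (o : A) (i : B) : graft o i = match o, i with
  | inl o, inl i => graft o i | inr o, inr i => graft o i | _, _ => false end.
Proof.
rewrite /graft; case: o i => o [] i;
  rewrite ?sum_in_l ?sum_in_r ?sum_out_l ?sum_out_r ?rAl ?rAr ?rBl ?rBr //.
- apply/negbTE/and3P => -[oO _ /eqP e].
  have := wrank_card (outG A1) o.
  by rewrite (wrank_in pA1 (@posO A1) oO) e ltnNge leq_addr.
- apply/negbTE/and3P => -[_ iI /eqP e].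
  have := wrank_card (inG B1) i.
  by rewrite (wrank_in pB1 (@posI B1) iI) -e -h1 ltnNge leq_addr.
- by rewrite eqn_add2l.
Qed.

Lemma sum_merged (a : A) (b : B) : merged a b = match a, b with
  | inl a, inl b => merged a b | inr a, inr b => merged a b | _, _ => false end.
Proof.
case: a b => a [] b.
- apply/mergedP/mergedP => [[[o|o] [[i|i] []]]|[o [i [g s t]]]] //.
    by rewrite sum_graft; exists o, i.
  by exists (inl o), (inl i); rewrite sum_graft.
- by apply/negbTE/negP => /mergedP[[o|o] [[i|i] []]] //; rewrite sum_graft.
- by apply/negbTE/negP => /mergedP[[o|o] [[i|i] []]] //; rewrite sum_graft.
- apply/mergedP/mergedP => [[[o|o] [[i|i] []]]|[o [i [g s t]]]] //.
    by rewrite sum_graft; exists o, i.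
  by exists (inr o), (inr i); rewrite sum_graft.
Qed.

Lemma sum_keep_l (x : A1 + B1) :
  comp_keep (match x with inl a => inl (inl a) | inr b => inr (inl b) end : A + B)
  = comp_keep x.
Proof.
case: x => x /=; rewrite exists_sum.
  rewrite [X in _ || X]existsb_false => [|i]; last by rewrite sum_graft.
  by rewrite orbF; under eq_existsb do rewrite sum_graft.
rewrite [X in _ || X]existsb_false => [|i]; last by rewrite sum_graft.
by rewrite orbF; under eq_existsb do rewrite sum_graft.
Qed.

Lemma sum_keep_r (x : A2 + B2) :
  comp_keep (match x with inl a => inl (inr a) | inr b => inr (inr b) end : A + B)
  = comp_keep x.
Proof.
case: x => x /=; rewrite exists_sum.
  rewrite [X in X || _]existsb_false => [|i]; last by rewrite sum_graft.
  by under eq_existsb do rewrite sum_graft.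
rewrite [X in X || _]existsb_false => [|i]; last by rewrite sum_graft.
by under eq_existsb do rewrite sum_graft.
Qed.

End SumGraft.

(** The isomorphism regroups (A1 + B1) + (A2 + B2) as (A1 + A2) + (B1 + B2),
    restricted to the surviving half-edges. *)
Lemma tensor_comp_interchange (D : tensor_scheme) (A1 A2 B1 B2 : diagram D)
    (h1 : cod A1 = dom B1) (h2 : cod A2 = dom B2)
    (h : cod (tensor A1 A2) = dom (tensor B1 B2)) :
  diso (tensor (comp h1) (comp h2)) (comp h).
Proof.
have pA1 := graph_planar A1; have pB1 := graph_planar B1.
have pB2 := graph_planar B2; have hc := comp_card h1.
pose el (x : A1 + B1) : tensor A1 A2 + tensor B1 B2 :=
  match x with inl a => inl (inl a) | inr b => inr (inl b) end.
pose er (x : A2 + B2) : tensor A1 A2 + tensor B1 B2 :=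
  match x with inl a => inl (inr a) | inr b => inr (inr b) end.
have kl x : comp_keep (el x) = comp_keep x by apply: sum_keep_l.
have kr x : comp_keep (er x) = comp_keep x by apply: sum_keep_r.
pose F (u : tensor (comp h1) (comp h2)) : comp h := match u with
  | inl v => exist (fun x => comp_keep x) (el (val v)) (etrans (kl _) (valP v))
  | inr v => exist (fun x => comp_keep x) (er (val v)) (etrans (kr _) (valP v))
  end.
have rAl a : rank (outG (tensor A1 A2)) (inl a) = rank (outG A1) a.
  exact/sum_rank_l/sum_out_l.
have rAr a : rank (outG (tensor A1 A2)) (inr a) = #|outG A1| + rank (outG A2) a.
  by apply: sum_rank_r; [exact: sum_out_l | exact: sum_out_r].
have wBl b : wrank (inG (tensor B1 B2)) (inl b) = wrank (inG B1) b.
  exact/sum_wrank_l/sum_in_l.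
have wBr b : wrank (inG (tensor B1 B2)) (inr b) = #|outG A1| + wrank (inG B2) b.
  by rewrite hc; apply: sum_wrank_r; [exact: sum_in_l | exact: sum_in_r].
have mg := sum_merged pA1 pB1 hc.
apply: (@diso_intro _ _ _ F).
- case=> -[[x|x] kx] [] [[y|y] ky] //= [e];
    by congr (_ _); apply: val_inj; rewrite /= e.
- case=> [[[x|x]|[x|x]] kx].
  + have k : comp_keep (inl x : A1 + B1) by rewrite -kl.
    by exists (inl (exist _ (inl x) k)); apply: val_inj.
  + have k : comp_keep (inl x : A2 + B2) by rewrite -kr.
    by exists (inr (exist _ (inl x) k)); apply: val_inj.
  + have k : comp_keep (inr x : A1 + B1) by rewrite -kl.
    by exists (inl (exist _ (inr x) k)); apply: val_inj.
  + have k : comp_keep (inr x : A2 + B2) by rewrite -kr.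
    by exists (inr (exist _ (inr x) k)); apply: val_inj.
- by case=> -[[x|x] kx] [] [[y|y] ky] //=; rewrite mg ?andbF.
- by case=> -[[x|x] kx].
(* Edges of different pairs: the common number of outputs of A1 and inputs of
   B1 separates the ranks coming from the two pairs. *)
- case=> -[[x|x] kx] [] [[y|y] ky] //=; rewrite ?mg ?rAl ?rAr ?wBl ?wBr ?andbT //.
  + apply: leq_ltn_trans (rank_card _ x) _.
    by rewrite -[X in X < _]addn0 ltn_add2l wrank_in_gt0.
  + by rewrite (leq_trans (wrank_card _ x)) // -hc leq_addr.
  + by apply/negbTE; rewrite -leqNgt (leq_trans (wrank_card _ y)) // -hc leq_addr.
  + by rewrite ltn_add2l.
  + apply/negbTE; rewrite -ltnNge (leq_ltn_trans (rank_card _ y)) //.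
    by rewrite -[X in X < _]addn0 ltn_add2l wrank_in_gt0.
  + by rewrite leq_add2l.
- by case=> -[[x|x] kx].
- by case=> -[[x|x] kx].
Qed.

(** * Relabelling of diagrams *)

Lemma tnth_map_cast (X Y : Type) (g : X -> Y) (v : seq X) (w : seq Y)
    (e : size v = size w) (i : 'I_(size v)) : w = map g v ->
  tnth (in_tuple w) (cast_ord e i) = g (tnth (in_tuple v) i).
Proof.
move=> ew; have y := g (tnth (in_tuple v) i); have z := tnth (in_tuple v) i.
by rewrite (tnth_nth y) (tnth_nth z) /= ew (nth_map z).
Qed.

Section RelabelFunctor.
Context {D E : tensor_scheme} (phi : scheme_mor D E).
Implicit Types A B : diagram D.

Lemma relabel_tensor A B :
  diso (relabel phi (tensor A B)) (tensor (relabel phi A) (relabel phi B)).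
Proof.
(* both sides have the same half-edges, the identity is the isomorphism *)
pose F (u : relabel phi (tensor A B)) :
  tensor (relabel phi A) (relabel phi B) := u.
apply: (@diso_intro _ _ _ F) => //; first by move=> y; exists y.
  by case.
by case.
Qed.

(** The two composites share their half-edges and structure maps; only the
    proofs of planarity differ. *)
Lemma relabel_comp A B (h : cod A = dom B)
    (h' : cod (relabel phi A) = dom (relabel phi B)) :
  diso (relabel phi (comp h)) (comp h').
Proof.
pose F (u : relabel phi (comp h)) : comp h' := u.
apply: (@diso_intro _ (relabel phi (comp h)) (comp h') F) => //.
- by move=> y; exists y.
- by case=> -[].
- by case=> -[].
Qed.

(** The numbers of inputs and outputs of f and of its image agree only up to a
    proved equality, whence the casts of ordinals. *)
Lemma relabel_prime (f : Mor D) :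
  diso (relabel phi (prime_diagram f)) (prime_diagram (mmor phi f)).
Proof.
have es : size (src f) = size (src (mmor phi f)) by rewrite src_mmor size_map.
have et : size (tgt f) = size (tgt (mmor phi f)) by rewrite tgt_mmor size_map.
pose F (x : relabel phi (prime_diagram f)) : prime_diagram (mmor phi f) :=
  match x with inl i => inl (cast_ord es i) | inr j => inr (cast_ord et j) end.
apply: (@diso_intro _ _ _ F) => //.
- by case=> i [] j // /(congr1 (fun z => match z with inl i => val i | inr i => val i end)) /= /val_inj ->.
- case=> i; [exists (inl (cast_ord (esym es) i))|exists (inr (cast_ord (esym et) i))];
    by rewrite /= cast_ordKV.
- by case.
- by case=> i [].
- by case=> i; apply: tnth_map_cast; rewrite ?src_mmor ?tgt_mmor.
Qed.

End RelabelFunctor.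

(** * Evaluation in a tensor manifold *)

(** The third component is a predicate, the class of a diagram; it is the
    extensionality of propositions that identifies the classes of isomorphic
    representatives. *)
Lemma Tmor_eq (D : tensor_scheme) (b c : Mor (T D)) (G K : diagram D) :
  src b = src c -> tgt b = tgt c -> bclass b G -> bclass c K -> diso G K -> b = c.
Proof.
case: b => bs bt bc b1 b2 b3; case: c => cs ct cc c1 c2 c3 /= es et bG cK GK.
subst cs ct; have ec : bc = cc.
  have [[G0 [_ _ hG]] [K0 [_ _ hK]]] := (b3, c3).
  have iG := iffLR (hG _) bG; have iK := iffLR (hK _) cK.
  have i0 : diso G0 K0 := diso_trans iG (diso_trans GK (diso_sym iK)).
  apply/funext => X; apply/propext; rewrite hG hK.
  by split; apply: diso_trans => //; apply: diso_sym.
by subst cc; congr Bracketed; apply: Prop_irrelevance.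
Qed.

(** Associativity of eps for a diagram A in T(M) all of whose boundary words are
    one-letter words: decorating the vertices of A by their values and then
    evaluating gives the same as evaluating the diagram K obtained by
    substitution. The morphism of T(T(M)) to which the algebra axiom applies is
    A with each boundary letter in a bracket of its own; both T(eps) and mu
    turn these brackets into one-letter words of M. *)
Lemma eps_value (M : tensor_manifold) (x y : seq (Ob M)) (A : diagram (T M))
    (K B : diagram M) (b c : Mor (T M)) :
  dom A = letters x -> cod A = letters y -> value A K ->
  diso (relabel (eps M) A) B ->
  src b = letters x -> tgt b = letters y -> bclass b B ->
  src c = letters x -> tgt c = letters y -> bclass c K ->
  mmor (eps M) b = mmor (eps M) c.
Proof.
move=> dA cA vA rA sb tb cb sc tc cc.
have hx : 0 < size (letters (letters x)) by rewrite size_map -sb (bsrc_gt0 b).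
have hy : 0 < size (letters (letters y)) by rewrite size_map -tb (btgt_gt0 b).
have dA' : dom A = flatten (letters (letters x)) by rewrite flatten_letters.
have cA' : cod A = flatten (letters (letters y)) by rewrite flatten_letters.
have flat (w : seq (Ob M)) : map (@mu_ob M) (letters (letters w)) = letters w.
  by rewrite /letters -!map_comp.
have epsl (w : seq (Ob M)) :
    map (map (mob (eps M))) (letters (letters w)) = letters w.
  rewrite -[in RHS](eps_letters w) /letters -!map_comp; exact: eq_map.
pose a : Mor (T (T M)) := @bracket (T M) _ _ A hx hy dA' cA'.
have mu : is_mu a c.
  split; rewrite ?sc ?tc; try by rewrite /= flat.
  by exists A, K; split=> //; apply: diso_refl.
rewrite -(eps_mu_mor mu); congr mmor.
apply: (@Tmor_eq M _ _ B B) => //; last exact: diso_refl.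
- by rewrite sb /= epsl.
- by rewrite tb /= epsl.
- by exists A => //; apply: diso_refl.
Qed.

Theorem proposition6p2p3 (M : tensor_manifold) (f1 g1 f2 g2 : Mor M)
    (h1 : tgt f1 = src g1) (h2 : tgt f2 = src g2) :
  eps_comp (eps_tensor g1 g2) (eps_tensor f1 f2) (eps_tensor_match h1 h2) =
  eps_tensor (eps_comp g1 f1 h1) (eps_comp g2 f2 h2).
Proof.
(* inner bracketed diagrams: vertices of the diagrams in T(M) to substitute in *)
pose tf : Mor (T M) := bracket (eps_tensor_src_gt0 f1 f2) (eps_tensor_tgt_gt0 f1 f2)
  (eps_tensor_dom f1 f2) (eps_tensor_cod f1 f2).
pose tg : Mor (T M) := bracket (eps_tensor_src_gt0 g1 g2) (eps_tensor_tgt_gt0 g1 g2)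
  (eps_tensor_dom g1 g2) (eps_tensor_cod g1 g2).
pose c1 : Mor (T M) := bracket (letters_src_gt0 f1) (letters_tgt_gt0 g1)
  (eps_comp_dom h1) (eps_comp_cod h1).
pose c2 : Mor (T M) := bracket (letters_src_gt0 f2) (letters_tgt_gt0 g2)
  (eps_comp_dom h2) (eps_comp_cod h2).
have htfg : tgt tf = src tg by rewrite /= h1 h2.
have hK : cod (tensor (prime_diagram f1) (prime_diagram f2)) =
    dom (tensor (prime_diagram g1) (prime_diagram g2)).
  by rewrite eps_tensor_cod eps_tensor_dom h1 h2.
have hA : cod (prime_diagram tf) = dom (prime_diagram tg).
  by rewrite cod_prime dom_prime.
have vK : value (comp hA) (comp hK).
  by apply: value_comp; apply: value_prime; apply: diso_refl.
have vT : value (tensor (prime_diagram c1) (prime_diagram c2)) (comp hK).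
  apply: value_iso (tensor_comp_interchange (eps_comp_prime h1) (eps_comp_prime h2) hK) _; first exact: diso_refl.
  by apply: value_tensor; apply: value_prime; apply: diso_refl.
have dK : dom (comp hK) = flatten (letters (src f1 ++ src f2)).
  by rewrite dom_comp eps_tensor_dom.
have cK : cod (comp hK) = flatten (letters (tgt g1 ++ tgt g2)).
  by rewrite cod_comp eps_tensor_cod.
pose c : Mor (T M) :=
  bracket (eps_tensor_src_gt0 f1 f2) (eps_tensor_tgt_gt0 g1 g2) dK cK.
transitivity (mmor (eps M) c).
  have hB : cod (relabel (eps M) (prime_diagram tf)) =
      dom (relabel (eps M) (prime_diagram tg)).
    by rewrite cod_relabel dom_relabel hA.
  apply: (@eps_value M (src f1 ++ src f2) (tgt g1 ++ tgt g2) _ _ _ _ c _ _ vK).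
  - by rewrite dom_comp dom_prime.
  - by rewrite cod_comp cod_prime.
  - apply: diso_trans (relabel_comp hA hB) _.
    by apply: (diso_comp _ (eps_comp_prime (eps_tensor_match h1 h2)));
      apply: relabel_prime.
  - by rewrite /= src_eps_tensor.
  - by rewrite /= tgt_eps_tensor.
  - exact: diso_refl.
  - by [].
  - by [].
  - exact: diso_refl.
apply/esym.
apply: (@eps_value M (src f1 ++ src f2) (tgt g1 ++ tgt g2) _ _ _ _ c _ _ vT).
- by rewrite dom_tensor !dom_prime /letters map_cat.
- by rewrite cod_tensor !cod_prime /letters map_cat.
- apply: diso_trans (relabel_tensor _ _ _) _.
  by apply: diso_tensor; apply: relabel_prime.
- by rewrite /= !src_eps_comp.
- by rewrite /= !tgt_eps_comp.
- exact: diso_refl.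
- by [].
- by [].
- exact: diso_refl.
Qed.
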